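(* Let $X$ be a set of seven points in $\mathbb{R}^2$. Then there are at least four distinct Tverberg partitions of $X$ into three parts, i.e. at least four distinct (unordered) partitions $X = A_1 \sqcup A_2 \sqcup A_3$ into three parts with $\operatorname{conv}(A_1)\cap\operatorname{conv}(A_2)\cap\operatorname{conv}(A_3)\neq\emptyset$.
   Context: A Tverberg partition of a finite set $X\subset\mathbb{R}^d$ into $r$ parts is a partition of $X$ into $r$ parts whose convex hulls have a point in common. Partitions are counted as unordered collections of parts. *)

(* Defs.v *)
From mathcomp Require Import all_boot all_order all_algebra.
From mathcomp Require Import finmap.
From mathcomp Require Import boolp classical_sets reals convex.

Set Implicit Arguments.
Unset Strict Implicit.
Unset Printing Implicit Defensive.

Import GRing.Theory Num.Theory.

Local Open Scope classical_set_scope.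
Local Open Scope ring_scope.

Definition conv_hull (R : realType) (d : nat) (A : set 'rV[R]_d) :
    set 'rV[R]_d :=
  smallest (fun C : set 'rV[R]_d =>
    convex_set (C : set (convex_lmodType 'rV[R]_d))) A.

(* The elements of X form the finite type [X], so a part of X is a [{set X}]
   and an unordered collection of parts is a [{set {set X}}]. *)
Definition points_of (R : realType) (d : nat) (X : {fset 'rV[R]_d})
    (A : {set X}) : set 'rV[R]_d :=
  [set val a | a in [set` A]].

(* [finset.partition] already requires the parts to be nonempty. *)
Definition tverberg_partitions (R : realType) (d : nat) (X : {fset 'rV[R]_d})
    (r : nat) : {set {set {set X}}} :=
  [set P : {set {set X}} |
    [&& finset.partition P [set: X]%SET, #|P| == r &
      `[< \bigcap_(A in [set` P]) conv_hull (points_of A) !=set0 >]]]%SET.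

(* Main.v *)
Require Import Defs.
From mathcomp Require Import all_boot all_order all_algebra.
From mathcomp Require Import finmap.
From mathcomp Require Import boolp classical_sets reals convex.
From mathcomp Require Import interval_inference topology normedtype derive.
From mathcomp Require Import ring lra ssrZ.

(** For seven points P_i in general position let D be the centre region: the points
    p such that every closed half-plane containing p contains at least three of
    the P_i.  It is nonempty by Helly's theorem and is cut out by the "heavy" lines,
    those through two of the points with at most two points strictly beyond them.
    A vertex of D which is not a P_i is the crossing of two segments P_a P_b and
    P_c P_d and lies in the triangle of the three other points, so it gives a
    Tverberg partition, and distinct vertices give distinct partitions.  If P_o
    lies in D, the six other points split in at least two ways into two triangles
    around P_o, and in four ways when D = {P_o}.
    If D contains no P_i, it is a polygon with at least four vertices: were it a
    triangle, its edges would lie on the lines of three disjoint pairs, and the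
    seventh point would be inside.  If it contains P_o alone and another point, two
    of its vertices differ from P_o; if it contains two of the P_i, each yields two
    partitions.
    Arbitrary points are limits of points in general position, and having a
    common point in the convex hulls of given parts is a closed condition. *)

Module SevenPoints.

Set Implicit Arguments.
Unset Strict Implicit.
Unset Printing Implicit Defensive.
Import Order.TTheory GRing.Theory Num.Theory numFieldNormedType.Exports.
Local Open Scope set_scope.
Local Open Scope ring_scope.

(** * Signed areas and lines in the plane *)

Definition cross (R : pzRingType) (u v : R * R) : R := u.1 * v.2 - u.2 * v.1.

Definition dot (R : pzRingType) (u v : R * R) : R := u.1 * v.1 + u.2 * v.2.

Definition orient (R : pzRingType) (p q r : R * R) : R := cross (q - p) (r - p).

(** The determinant of the values at [a] and [b] of the two affine functions that cut out the lines
    [cd] and [ef]: a division-free test for concurrency with the line [ab]. Being polynomial, it can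
    also be evaluated over the integers and over polynomials. *)
Definition concur (R : pzRingType) (a b c d e f : R * R) : R :=
  orient a c d * orient b e f - orient b c d * orient a e f.

Section Affine.
Variable R : realFieldType.
Implicit Types p q r u v : R * R.

Lemma plane_eq p q : p.1 = q.1 -> p.2 = q.2 -> p = q.
Proof. by case: p q => [? ?] [? ?] /= -> ->. Qed.

Lemma orientE p q r :
  orient p q r = (q.1 - p.1) * (r.2 - p.2) - (q.2 - p.2) * (r.1 - p.1).
Proof. by []. Qed.

Lemma orient_cyc p q r : orient p q r = orient q r p.
Proof. rewrite !orientE; ring. Qed.

Lemma orient_swap p q r : orient p q r = - orient p r q.
Proof. rewrite !orientE; ring. Qed.

Lemma orient_aba p q : orient p q p = 0.
Proof. rewrite orientE; ring. Qed.

Lemma orient_abb p q : orient p q q = 0.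
Proof. rewrite orientE; ring. Qed.

Lemma orient_move p q r u (t : R) :
  orient p q (r.1 + t * u.1, r.2 + t * u.2) = orient p q r + t * cross (q - p) u.
Proof. rewrite /orient /cross /=; ring. Qed.

(** Finitely many strict inequalities survive a common small step; each [j] allows any step up to
    [- f j / (1 + |g j|)], where the 1 excludes a zero denominator. *)
Lemma eps_neg (J : finType) (f g : J -> R) :
  exists2 e, 0 < e & forall j, f j < 0 -> f j + e * `|g j| < 0.
Proof.
suff [e e0 H] : exists2 e, 0 < e &
    forall j, j \in enum J -> f j < 0 -> f j + e * `|g j| < 0.
  by exists e => // j; apply: H; rewrite mem_enum.
elim: (enum J) => [|k s [e e0 IH]]; first by exists 1.
have [fk|fk] := ltP (f k) 0; last first.
  by exists e => // j; rewrite inE => /predU1P[->|/IH//]; rewrite ltNge fk.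
have g0 : 0 < 1 + `|g k| by rewrite ltr_pwDl.
exists (Num.min e (- f k / (1 + `|g k|))).
  by rewrite lt_min e0 divr_gt0 // oppr_gt0.
move=> j; rewrite inE => /predU1P[->|js] fj.
  have : Num.min e (- f k / (1 + `|g k|)) * (1 + `|g k|) <= - f k.
    by rewrite -ler_pdivlMr // ge_min lexx orbT.
  have : 0 < Num.min e (- f k / (1 + `|g k|)).
    by rewrite lt_min e0 divr_gt0 // oppr_gt0.
  by move: (normr_ge0 (g k)); nra.
apply: le_lt_trans (IH j js fj); rewrite lerD2l ler_wpM2r //.
by rewrite ge_min lexx.
Qed.

Lemma cross_kernel u v w : cross u w = 0 -> cross v w = 0 -> cross u v != 0 ->
  w = 0.
Proof.
move=> uw vw uv; apply: plane_eq; apply: (mulfI uv); rewrite mulr0.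
  transitivity (v.1 * cross u w - u.1 * cross v w); last by rewrite uw vw; ring.
  by rewrite /cross; ring.
transitivity (v.2 * cross u w - u.2 * cross v w); last by rewrite uw vw; ring.
by rewrite /cross; ring.
Qed.

Lemma lines_meet_once a b c d p q : cross (b - a) (d - c) != 0 ->
  orient a b p = 0 -> orient c d p = 0 ->
  orient a b q = 0 -> orient c d q = 0 -> p = q.
Proof.
move=> nz abp cdp abq cdq; apply/eqP; rewrite -subr_eq0; apply/eqP.
apply: (cross_kernel _ _ nz).
  by transitivity (orient a b p - orient a b q);
    [rewrite /orient /cross /=; ring|rewrite abp abq subrr].
by transitivity (orient c d p - orient c d q);
  [rewrite /orient /cross /=; ring|rewrite cdp cdq subrr].
Qed.

Lemma dot_gt0 u : u != 0 -> 0 < dot u u.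
Proof.
rewrite lt_neqAle addr_ge0 -?expr2 ?sqr_ge0 // andbT [0 == _]eq_sym.
apply: contraNN; rewrite paddr_eq0 -?expr2 ?sqr_ge0 // !sqrf_eq0.
by move=> /andP[/eqP u1 /eqP u2]; apply/eqP/plane_eq.
Qed.

Lemma line_param a b p : a != b -> orient a b p = 0 ->
  exists t, p = (a.1 + t * (b - a).1, a.2 + t * (b - a).2).
Proof.
move=> ab abp; have nz : dot (b - a) (b - a) != 0.
  by rewrite gt_eqF // dot_gt0 // subr_eq0 eq_sym.
(* The parameter of the orthogonal projection of [p] to the line. *)
exists (dot (p - a) (b - a) / dot (b - a) (b - a)).
apply: plane_eq => /=; apply: (mulIf nz); rewrite mulrDl mulrAC divfK //;
  apply/eqP; rewrite -subr_eq0; apply/eqP.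
- transitivity (- (b - a).2 * orient a b p); last by rewrite abp mulr0.
  rewrite /orient /dot /cross /=; ring.
- transitivity ((b - a).1 * orient a b p); last by rewrite abp mulr0.
  rewrite /orient /dot /cross /=; ring.
Qed.

(** At [p], a point of parameter [t] on the line [ab], both affine functions vanish, so [(1 - t, t)]
    is in the kernel of the matrix whose determinant is [concur]. *)
Lemma concur_eq0 a b c d e f p : a != b ->
  orient a b p = 0 -> orient c d p = 0 -> orient e f p = 0 ->
  concur a b c d e f = 0.
Proof.
move=> ab /(line_param ab)[t ->].
have H x y : orient x y (a.1 + t * (b - a).1, a.2 + t * (b - a).2) =
    (1 - t) * orient a x y + t * orient b x y.
  by rewrite /orient /cross /=; ring.
rewrite !H /concur => cd ef.
transitivity (orient b e f * ((1 - t) * orient a c d + t * orient b c d)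
  - orient b c d * ((1 - t) * orient a e f + t * orient b e f)
  + orient a c d * ((1 - t) * orient a e f + t * orient b e f)
  - orient a e f * ((1 - t) * orient a c d + t * orient b c d)); last by rewrite cd ef; ring.
ring.
Qed.

(* orient p q is affine: its value at z is the barycentric combination of its values
   at r, x and y, here multiplied by the denominator orient r x y. *)
Lemma orient_bary p q r x y z :
  orient p q z * orient r x y =
  orient p q r * orient z x y + orient p q x * orient r z y
  + orient p q y * orient r x z.
Proof. rewrite /orient /cross /=; ring. Qed.

End Affine.

(** * Helly's theorem in the plane for finite families *)

Section Helly.
Variable R : realFieldType.

(** Four points suffice for Radon's argument in the plane. Membership is asked only of the points of
    positive weight, so that both halves of a Radon partition are sums over the same index set. *)
Definition convex4 (C : R * R -> Prop) := forall (w : 'I_4 -> R) (p : 'I_4 -> R * R),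
  (forall i, 0 <= w i) -> \sum_i w i = 1 -> (forall i, 0 < w i -> C (p i)) ->
  C (\sum_i w i * (p i).1, \sum_i w i * (p i).2).

Lemma convex4I C D : convex4 C -> convex4 D -> convex4 (fun p => C p /\ D p).
Proof.
by move=> hC hD w p w0 w1 CD; split; [apply: hC|apply: hD] => // i /CD[].
Qed.

Lemma convex4_halfplane a b : convex4 (fun p => orient a b p <= 0).
Proof.
move=> w p w0 w1 H.
have -> : orient a b (\sum_i w i * (p i).1, \sum_i w i * (p i).2) =
    \sum_i w i * orient a b (p i).
  transitivity (\sum_i w i * orient a b (p i) +
      (1 - \sum_i w i) * orient a b 0); last by rewrite w1; ring.
  by rewrite !big_ord_recr !big_ord0 /orient /cross /=; ring.
apply: sumr_le0 => i _; have [/H Hi|wi] := ltP 0 (w i); first by rewrite mulr_ge0_le0.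
have -> : w i = 0 by apply/eqP; rewrite eq_le wi w0.
by rewrite mul0r.
Qed.

(** The four rows [(1, x, y)] live in a space of dimension three. *)
Lemma affine_dependency (p : 'I_4 -> R * R) : exists l : 'I_4 -> R,
  [/\ exists i, l i != 0, \sum_i l i = 0, \sum_i l i * (p i).1 = 0
    & \sum_i l i * (p i).2 = 0].
Proof.
pose M := \matrix_(i < 4, j < 3)
  (if j == 0 :> nat then 1 else if j == 1%N :> nat then (p i).1 else (p i).2).
have kM : kermx M != 0.
  by rewrite -mxrank_eq0 mxrank_ker -lt0n subn_gt0 (leq_ltn_trans (rank_leq_col M)).
have /rowV0Pn[v /sub_kermxP vM v0] := kM.
have hv j : \sum_i v 0 i * M i j = 0 by move/matrixP/(_ 0 j): vM; rewrite !mxE.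
exists (v 0); split.
- have /rV0Pn[i vi] := v0; by exists i.
- by rewrite -[RHS](hv 0); apply: eq_bigr => i _; rewrite mxE mulr1.
- by rewrite -[RHS](hv 1); apply: eq_bigr => i _; rewrite mxE.
- by rewrite -[RHS](hv 2); apply: eq_bigr => i _; rewrite mxE.
Qed.

(** Radon's argument: [p i] lies in all the sets except perhaps [C i]. The positive and the negative
    part of an affine dependency, divided by their common sum [S], write one point in two ways; for
    each [j], one of the two gives no weight to [p j]. *)
Lemma helly4 (C : 'I_4 -> R * R -> Prop) : (forall i, convex4 (C i)) ->
  (forall i, exists p, forall j, j != i -> C j p) -> exists p, forall i, C i p.
Proof.
move=> cC /choice[p Hp]; have [l [[k lk] l0 l1 l2]] := affine_dependency p.
pose pos i := Num.max (l i) 0; pose neg i := Num.max (- l i) 0.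
have pn i : l i = pos i - neg i.
  by rewrite /pos /neg; case: ltgtP => ?; case: ltgtP => ?; lra.
have pos0 i : 0 <= pos i by rewrite le_max lexx orbT.
have neg0 i : 0 <= neg i by rewrite le_max lexx orbT.
pose S := \sum_i pos i.
have SN : \sum_i neg i = S.
  apply/eqP; rewrite eq_sym -subr_eq0 -sumrB; apply/eqP; rewrite -[RHS]l0.
  by apply: eq_bigr => i _; rewrite -pn.
have S0 : 0 < S.
  rewrite lt_neqAle sumr_ge0 // andbT; apply/eqP => S0.
  move: (esym S0) => /eqP; rewrite psumr_eq0 // => /allP /(_ k (mem_index_enum k)) /=.
  move: SN; rewrite -S0 => /eqP; rewrite psumr_eq0 // => /allP /(_ k (mem_index_enum k)) /=.
  by move=> /eqP nk /eqP pk; move: lk; rewrite pn nk pk subrr eqxx.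
have E c : \sum_i l i * c i = 0 -> \sum_i pos i / S * c i = \sum_i neg i / S * c i.
  move=> h; apply/eqP; rewrite -subr_eq0 -sumrB; apply/eqP.
  transitivity (S^-1 * \sum_i l i * c i); last by rewrite h mulr0.
  rewrite mulr_sumr.
  by apply: eq_bigr => i _; rewrite pn; ring.
exists (\sum_i pos i / S * (p i).1, \sum_i pos i / S * (p i).2) => j.
have [lj|lj] := leP (l j) 0.
  apply: cC => [i||i]; first by rewrite divr_ge0 // ltW.
    by rewrite -mulr_suml divff // gt_eqF.
  rewrite pmulr_lgt0 ?invr_gt0 // => pi; apply: Hp; apply/eqP => ji.
  by move: pi; rewrite -ji /pos max_r // ltxx.
rewrite (E _ l1) (E _ l2); apply: cC => [i||i]; first by rewrite divr_ge0 // ltW.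
  by rewrite -mulr_suml SN divff // gt_eqF.
rewrite pmulr_lgt0 ?invr_gt0 // => pi; apply: Hp; apply/eqP => ji.
by move: pi; rewrite -ji /neg max_r ?ltxx // oppr_le0 ltW.
Qed.

(** Induction on the number of sets, two of them being replaced by their intersection; [helly4]
    keeps every three sets of the new family intersecting. Lists of predicates are used because this
    intersection need not be one of the [F t]. *)
Lemma helly (T : finType) (F : T -> R * R -> Prop) :
  (forall t, convex4 (F t)) ->
  (forall a b c, exists p, [/\ F a p, F b p & F c p]) ->
  exists p, forall t, F t p.
Proof.
move=> cF F3.
suff H n : forall l : seq (R * R -> Prop), size l = n ->
    (forall C, List.In C l -> convex4 C) ->
    (forall A B C, List.In A l -> List.In B l -> List.In C l ->
       exists p, [/\ A p, B p & C p]) ->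
    exists p, forall C, List.In C l -> C p.
  have [||p Hp] := H _ (map F (enum T)) erefl.
  - by move=> C /List.in_map_iff[t [<- _]].
  - by move=> _ _ _ /List.in_map_iff[a [<- _]] /List.in_map_iff[b [<- _]]
      /List.in_map_iff[c [<- _]].
  exists p => t; apply: Hp; have : t \in enum T by rewrite mem_enum.
  by elim: (enum T) => //= x s IH; rewrite inE => /predU1P[->|/IH ?]; [left|right].
elim: n => [|[|n] IH] l.
- by case: l => // _ _ _; exists 0.
- case: l => [|A [|]] // _ _ H; have [||| p [Ap _ _]] := H A A A; try by left.
  by exists p => C [<-|[]].
case: l => [|A [|B l]] // [sl] cl H.
have inA : List.In A (A :: B :: l) by left.
have inB : List.In B (A :: B :: l) by right; left.
have inl C : List.In C l -> List.In C (A :: B :: l) by right; right.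
have AB3 C D : List.In C (A :: B :: l) -> List.In D (A :: B :: l) ->
    exists p, [/\ A p /\ B p, C p & D p].
  move=> iC iD; pose f (i : 'I_4) := nth A [:: A; B; C; D] i.
  have fi i : List.In (f i) (A :: B :: l).
    case: i => -[|[|[|[|//]]]] ?;
      [exact: inA|exact: inB|exact: iC|exact: iD].
  have [||p Hp] := @helly4 f.
  - by move=> i; exact: cl (fi i).
  - move=> i.
    have [p [p1 p2 p3]] := H _ _ _ (fi (lift i 0)) (fi (lift i 1)) (fi (lift i 2)).
    exists p => j ji; have [k ->] : exists k, j = lift i k.
      by case: (unliftP i j) ji => [k -> _|->]; [exists k|rewrite eqxx].
    by case: k => -[|[|[|//]]] kp; [move: p1|move: p2|move: p3];
      congr (f (lift i _) p); exact: val_inj.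
  exists p; split; first split.
  + exact: (Hp 0). + exact: (Hp 1). + exact: (Hp 2). + exact: (Hp 3).
have [||| p Hp] := IH ((fun p => A p /\ B p) :: l).
- by rewrite /= sl.
- move=> C [<-|/inl/cl//]; apply: convex4I; exact: cl.
- move=> C D K [<-|iC] [<-|iD] [<-|iK].
  + by have [p [? ? ?]] := AB3 A B inA inB; exists p.
  + by have [p [? ? ?]] := AB3 K B (inl _ iK) inB; exists p.
  + by have [p [? ? ?]] := AB3 D B (inl _ iD) inB; exists p.
  + by have [p [? ? ?]] := AB3 D K (inl _ iD) (inl _ iK); exists p.
  + by have [p [? ? ?]] := AB3 C B (inl _ iC) inB; exists p.
  + by have [p [? ? ?]] := AB3 C K (inl _ iC) (inl _ iK); exists p.
  + by have [p [? ? ?]] := AB3 C D (inl _ iC) (inl _ iD); exists p.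
  + by apply: H; apply: inl.
have [Ap Bp] := Hp _ (or_introl erefl).
by exists p => C [<-|[<-|iC]] //; apply: Hp; right.
Qed.

End Helly.

(** * Heavy lines and convex hulls of a labelled configuration *)

Section Configuration.
Variables (R : realFieldType) (I : finType) (P : I -> R * R).
Implicit Types (a b c d e f i j : I) (p q u v : R * R) (A K : {set I}).

Definition left a b : {set I} := [set i | 0 < orient (P a) (P b) (P i)]%SET.

(** The pair is ordered: the light side of the line is the one to the left of the direction from
    [P a] to [P b]. *)
Definition heavy a b := (a != b) && (#|left a b| <= 2)%N.

Definition center p := forall a b, heavy a b -> orient (P a) (P b) p <= 0.

Definition generic :=
  [/\ forall a b c, uniq [:: a; b; c] -> orient (P a) (P b) (P c) != 0,
      forall a b c d, uniq [:: a; b; c; d] -> cross (P b - P a) (P d - P c) != 0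
    & forall a b c d e f, uniq [:: a; b; c; d; e; f] ->
        concur (P a) (P b) (P c) (P d) (P e) (P f) != 0].

Definition in_hull A p := exists w : I -> R,
  [/\ forall i, 0 <= w i, forall i, i \notin A -> w i = 0, \sum_i w i = 1
    & p = (\sum_i w i * (P i).1, \sum_i w i * (P i).2)].

(** The three indices may coincide, so that points and segments are treated as degenerate
    triangles. *)
Lemma in_hull3 A a b c (x y z : R) : a \in A -> b \in A -> c \in A ->
  0 <= x -> 0 <= y -> 0 <= z -> x + y + z = 1 ->
  in_hull A (x * (P a).1 + y * (P b).1 + z * (P c).1,
             x * (P a).2 + y * (P b).2 + z * (P c).2).
Proof.
move=> aA bA cA x0 y0 z0 xyz.
pose w i := x * (i == a)%:R + y * (i == b)%:R + z * (i == c)%:R.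
have S (h : I -> R) : \sum_i w i * h i = x * h a + y * h b + z * h c.
  under eq_bigr do rewrite /w !mulrDl.
  have E y' j : \sum_i y' * (i == j)%:R * h i = y' * h j.
    rewrite (bigD1 j) //= eqxx mulr1 big1 ?addr0 // => i /negPf->.
    by rewrite mulr0 mul0r.
  by rewrite !big_split /= !E.
exists w; split.
- by move=> i; rewrite !addr_ge0 // mulr_ge0.
- move=> i iA; rewrite /w.
  have N j : j \in A -> (i == j) = false by move=> jA; apply: contraNF iA => /eqP->.
  by rewrite !N // !mulr0 !addr0.
- by transitivity (\sum_i w i * 1); [apply: eq_bigr => i _; rewrite mulr1|rewrite S !mulr1].
- by rewrite !S.
Qed.

Lemma in_hull_point a : in_hull [set a]%SET (P a).
Proof.
have := @in_hull3 [set a]%SET a a a 1 0 0; rewrite !inE eqxx !mul1r !mul0r !addr0.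
by case: (P a) => ? ? /=; apply.
Qed.

Lemma in_hull_segment a b (t : R) : 0 <= t <= 1 ->
  in_hull [set a; b]%SET ((P a).1 + t * (P b - P a).1, (P a).2 + t * (P b - P a).2).
Proof.
move=> /andP[t0 t1].
have := @in_hull3 [set a; b]%SET a b b (1 - t) t 0.
rewrite !inE !eqxx orbT subr_ge0 => /(_ isT isT isT t1 t0 (lexx _)).
rewrite !mul0r !addr0 subrK => /(_ erefl).
by congr in_hull; apply: plane_eq => /=; ring.
Qed.

(** The barycentric coordinates of [p] are quotients of signed areas by that of the triangle;
    multiplying by the latter instead makes the hypotheses independent of the orientation. *)
Lemma in_hull_triangle a b c p : orient (P a) (P b) (P c) != 0 ->
  0 <= orient (P a) (P b) (P c) * orient (P a) (P b) p ->
  0 <= orient (P a) (P b) (P c) * orient (P b) (P c) p ->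
  0 <= orient (P a) (P b) (P c) * orient (P c) (P a) p ->
  in_hull [set a; b; c]%SET p.
Proof.
set W := orient _ _ _ => W0 Hc Ha Hb.
have := @in_hull3 [set a; b; c]%SET a b c (orient (P b) (P c) p / W)
  (orient (P c) (P a) p / W) (orient (P a) (P b) p / W).
rewrite !inE !eqxx !orbT => /(_ isT isT isT).
have D x : 0 <= W * x -> 0 <= x / W.
  by move=> Wx; have := divr_ge0 Wx (sqr_ge0 W); congr (_ <= _); field.
move=> /(_ (D _ Ha) (D _ Hb) (D _ Hc)).
rewrite -!mulrDl => H.
have E : orient (P b) (P c) p + orient (P c) (P a) p + orient (P a) (P b) p = W.
  rewrite /W /orient /cross /=; ring.
move: H; rewrite E divff // => /(_ erefl).
by congr in_hull; apply: plane_eq => /=; apply: (mulfI W0);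
  rewrite !mulrDr ![W * (_ / W * _)]mulrA ![W * (_ / W)]mulrC !divfK //
  /W /orient /cross /=; ring.
Qed.

Lemma in_hull_orient A a b p : in_hull A p ->
  (forall i, i \in A -> orient (P a) (P b) (P i) = 0) -> orient (P a) (P b) p = 0.
Proof.
case=> w [_ wA w1 ->] H.
transitivity (\sum_i w i * orient (P a) (P b) (P i)).
  transitivity ((P b - P a).1 * (\sum_i w i * (P i).2)
      - (P b - P a).2 * (\sum_i w i * (P i).1)
      - (\sum_i w i) * cross (P b - P a) (P a)).
    by rewrite w1 /orient /cross /=; ring.
  rewrite !mulr_sumr mulr_suml -!sumrB; apply: eq_bigr => i _.
  by rewrite /orient /cross /=; ring.
rewrite big1 // => i _.
by have [/H->|/wA->] := boolP (i \in A); rewrite ?mulr0 ?mul0r.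
Qed.

End Configuration.

(** * The centre region *)

Section Center.
Variables (R : realFieldType) (I : finType) (P : I -> R * R).
Hypotheses (cI : #|I| = 7%N) (gP : generic P).
Implicit Types (a b c d e f i j : I) (p q u v : R * R) (A K : {set I}).

Lemma generic_orient a b c : uniq [:: a; b; c] ->
  orient (P a) (P b) (P c) != 0.
Proof. by case: gP => H _ _; apply: H. Qed.

Lemma generic_cross a b c d : uniq [:: a; b; c; d] ->
  cross (P b - P a) (P d - P c) != 0.
Proof. by case: gP => _ H _; apply: H. Qed.

Lemma generic_concur a b c d e f : uniq [:: a; b; c; d; e; f] ->
  concur (P a) (P b) (P c) (P d) (P e) (P f) != 0.
Proof. by case: gP => _ _ H; apply: H. Qed.

Lemma card_setC_ge A n m : (#|A| <= n)%N -> (n + m = 7)%N -> (m <= #|~: A|)%N.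
Proof. by move=> An nm; rewrite -(leq_add2l n) nm -cI -(cardsC A) leq_add2r. Qed.

Lemma pick_other A (s : seq I) : (size s < #|A|)%N -> exists2 i, i \in A & i \notin s.
Proof.
move=> sA; apply/exists_inP; apply: contraLR sA => /exists_inPn H.
rewrite -leqNgt (leq_trans _ (card_size s)) //; apply/subset_leq_card/fintype.subsetP => i /H.
by rewrite negbK.
Qed.

Lemma P_inj : injective P.
Proof.
move=> a b ab; apply/eqP; apply: contraT => nab.
have [|c _] := @pick_other [set: I]%SET [:: a; b]; first by rewrite cardsT cI.
rewrite !inE negb_or => /andP[ca cb].
have /generic_orient : uniq [:: a; b; c].
  by rewrite /= !inE negb_or nab ![_ == c]eq_sym ca cb.
by rewrite ab orientE !subrr !mul0r subrr eqxx.
Qed.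

(** Three light sides contain at most six of the seven points, so some [P i] lies in all three
    closed opposite half-planes, and Helly's theorem applies. *)
Lemma center_exists : exists p, center P p.
Proof.
pose F (t : I * I) p := heavy P t.1 t.2 -> orient (P t.1) (P t.2) p <= 0.
have [||p Hp] := @helly R (I * I)%type F.
- move=> t w p w0 w1 H ht; apply: (@convex4_halfplane _ (P t.1) (P t.2)) => // i /H.
  exact.
- move=> t1 t2 t3.
  (* A pair that is not heavy imposes no constraint and gets the empty set. *)
  pose L t := if heavy P t.1 t.2 then left P t.1 t.2 else finset.set0.
  have L2 t : (#|L t| <= 2)%N.
    by rewrite /L; case: ifP => [/andP[]|]; rewrite ?cards0.
  have : (1 <= #|~: (L t1 :|: L t2 :|: L t3)|)%N.
    apply: (@card_setC_ge _ 6) => //.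
    rewrite (leq_trans (leq_card_setU _ _)) // (@leq_add _ _ 4 2) //.
    by rewrite (leq_trans (leq_card_setU _ _)) // (@leq_add _ _ 2 2).
  rewrite card_gt0 => /finset.set0Pn[i]; rewrite !inE !negb_or -andbA => /and3P[h1 h2 h3].
  by exists (P i); split => h; [move: h1|move: h2|move: h3];
    rewrite /L h inE -leNgt.
- by exists p => a b hab; apply: (Hp (a, b)).
Qed.

(* The hull of K has an edge at P e separating it from p, and that edge is heavy.
   The alternative under the disjunction lets K meet the ray from p beyond P e. *)
Lemma tangent p e K (sg : R) : center P p -> e \in K -> p != P e -> (5 <= #|K|)%N ->
  sg = 1 \/ sg = -1 ->
  (forall i, i \in K -> i != e -> sg * orient p (P e) (P i) < 0 \/
     orient p (P e) (P i) = 0 /\ 0 < dot (P e - p) (P i - P e)) -> False.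
Proof.
move=> cp eK pe K5 hsg H.
pose u := P e - p; pose al i := dot u (P i - P e); pose be i := orient p (P e) (P i).
have u0 : 0 < dot u u by rewrite dot_gt0 // subr_eq0 eq_sym.
(* Up to scale, [al] and [be] are the coordinates along and across the direction from [p] to
   [P e]. *)
have key i j : dot u u * orient (P e) (P i) (P j) = al i * be j - be i * al j.
  by rewrite /al /be /u /orient /dot /cross /=; ring.
(* Two further points of [K] on the ray would be collinear with [P e]. *)
have [i0 i0K bi0] : exists2 i, i \in K & sg * be i < 0.
  have [|i iK] := @pick_other K [:: e]; first exact: leq_trans K5.
  rewrite inE => ie.
  have [|j jK] := @pick_other K [:: e; i]; first exact: leq_trans K5.
  rewrite !inE negb_or => /andP[je ji].
  have [?|[bi _]] := H i iK ie; first by exists i.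
  have [?|[bj _]] := H j jK je; first by exists j.
  have /generic_orient/negP[] : uniq [:: e; i; j].
    by rewrite /= !inE negb_or ![_ == j]eq_sym eq_sym ie je ji.
  by rewrite -(mulrI_eq0 _ (mulfI (lt0r_neq0 u0))) key /be bi bj mul0r mulr0 subrr.
pose K' := [set i in K | sg * be i < 0].
have i0K' : i0 \in K' by rewrite inE i0K.
(* [r i] is the cotangent of the angle between [P i - P e] and [u]. Its minimum is attained at the
   widest angle, so that [K] lies on one side of the line through [P e] and [P c]. *)
pose r i := al i / - (sg * be i).
pose c := [arg min_(c < i0 in K') r c]%O.
have [cK bc rc] : [/\ c \in K, sg * be c < 0 & forall i, i \in K' -> r c <= r i].
  by rewrite /c; case: arg_minP => // k; rewrite inE => /andP[].
have sg2 : sg * sg = 1 by case: hsg => ->; rewrite ?mulrNN mulr1.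
have side i : i \in K -> 0 <= sg * orient (P e) (P c) (P i).
  move=> iK; rewrite -(pmulr_rge0 _ u0) mulrCA key.
  have [->|ie] := eqVneq i e.
    have -> : al e = 0 by rewrite /al /dot !subrr !mulr0 addr0.
    have -> : be e = 0 by rewrite /be /orient /cross; ring.
    by rewrite !mulr0 subrr mulr0.
  have [bi|[bi ai]] := H i iK ie.
    have : r c <= r i by apply: rc; rewrite inE iK.
    rewrite /r ler_pdivrMr ?oppr_gt0 // mulrAC ler_pdivlMr ?oppr_gt0 //.
    by rewrite /be => h; nra.
  rewrite -/(be i) in bi; rewrite bi mulr0 sub0r mulrN -mulNr.
  by rewrite mulrA mulNr mulr_ge0 ?oppr_ge0 // ltW.
have pside : sg * orient (P e) (P c) p < 0.
  by have -> : orient (P e) (P c) p = be c by rewrite /be orient_cyc orient_cyc orient_cyc orient_cyc.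
have ec : e != c.
  by apply/eqP => ec; move: pside; rewrite -ec orientE !subrr !mul0r subrr mulr0 ltxx.
(* At most two of the seven points are outside [K], so a line with [K] weakly on its right is
   heavy. *)
have light a b : a != b -> (forall i, i \in K -> orient (P a) (P b) (P i) <= 0) ->
    orient (P a) (P b) p <= 0.
  move=> ab Hab; apply: cp; rewrite /heavy ab /=.
  have : (#|~: K| <= 2)%N by rewrite -(leq_add2l #|K|) cardsC cI (leq_add K5).
  apply: leq_trans; apply/subset_leq_card/fintype.subsetP => i; rewrite !inE.
  by apply: contraTN => /Hab; rewrite leNgt.
move: side pside; case: hsg => -> side pside.
- have := light c e; rewrite eq_sym ec => /(_ isT) h; move: pside.
  rewrite mul1r orient_swap orient_cyc oppr_lt0 ltNge => /negP; apply.
  rewrite orient_cyc; apply: h => i /side.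
  by rewrite mul1r orient_swap orient_cyc orient_cyc oppr_ge0.
- move: pside; rewrite mulN1r oppr_lt0 ltNge => /negP; apply; apply: light => // i /side.
  by rewrite mulN1r oppr_ge0.
Qed.

(** Seen from [p], the points of an open half-plane bounded by a line through [p] span less than a
    half-turn, so there is an extreme ray. The point of [K] nearest to [p] on this ray fits
    [tangent]. *)
Lemma depth p (n : R * R) : center P p ->
  (5 <= #|[set i | (dot n (P i - p) < 0)%R]%SET|)%N -> False.
Proof.
move=> cp; set K := [set i | _]%SET => K5.
(* Up to scale, [nu] is the distance from the bounding line and [mu] the position along it, so [s]
   is the slope of the ray from [p] to [P i]. *)
pose nu i := - dot n (P i - p); pose mu i := cross n (P i - p); pose s i := mu i / nu i.
have nuK i : i \in K -> 0 < nu i by rewrite inE oppr_gt0.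
have nmu i : s i * nu i = mu i \/ i \notin K.
  have [iK|] := boolP (i \in K); [left|by right].
  by rewrite divfK // gt_eqF // nuK.
have key i j : dot n n * orient p (P i) (P j) = mu i * nu j - nu i * mu j.
  rewrite /mu /nu /orient /dot /cross /=; ring.
have [|i0 i0K _] := @pick_other K [::]; first exact: leq_trans K5.
have [k [kK smin]] : exists k, k \in K /\ forall i, i \in K -> s k <= s i.
  by case: (@arg_minP _ _ _ i0 (mem K) s i0K) => k kK km; exists k.
pose K0 := [set i in K | s i == s k].
have kK0 : k \in K0 by rewrite inE kK eqxx.
have [e [eK0 emin]] : exists e, e \in K0 /\ forall i, i \in K0 -> nu e <= nu i.
  by case: (@arg_minP _ _ _ k (mem K0) nu kK0) => e eK em; exists e.
have /andP[eK /eqP se] : (e \in K) && (s e == s k) by move: eK0; rewrite inE.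
have nue := nuK e eK.
have pe : p != P e.
  by apply: contraTneq nue => pe; rewrite /nu -pe /dot !subrr !mulr0 addr0 oppr0 ltxx.
have n0 : 0 < dot n n.
  apply: dot_gt0; apply: contraTneq nue => n0.
  by rewrite /nu /dot n0 !mul0r addr0 oppr0 ltxx.
apply: (@tangent p e K 1) => //; first by left.
move=> i iK ie; have nui := nuK i iK; rewrite mul1r.
have [mui|] := nmu i; last by rewrite iK.
have [mue|] := nmu e; last by rewrite eK.
have := smin i iK; rewrite -se le_eqVlt => /orP[/eqP si|si]; last first.
  left; rewrite -(pmulr_rlt0 _ n0) key -mui -mue.
  have -> : s e * nu e * nu i - nu e * (s i * nu i) = nu e * nu i * (s e - s i) by ring.
  by rewrite pmulr_rlt0 ?subr_lt0 // mulr_gt0.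
(* Here [P i] is on the extreme ray too, and beyond [P e] by the choice of [e]. *)
right; split.
  apply: (mulfI (lt0r_neq0 n0)); rewrite mulr0 key -mui -mue si; ring.
have nlt : nu e < nu i.
  rewrite lt_neqAle emin ?andbT; last by rewrite finset.in_set iK -si se eqxx.
  apply: contraNneq ie => nei; apply/eqP/P_inj.
  have /eqP : P i - P e = 0.
    have h1 : dot n (P i - P e) = 0.
      by transitivity (nu e - nu i); [rewrite /nu /dot /=; ring|rewrite nei subrr].
    have h2 : cross n (P i - P e) = 0.
      transitivity (mu i - mu e); first by rewrite /mu /cross /=; ring.
      by rewrite -mui -mue si nei subrr.
    apply: plane_eq => /=; apply: (mulfI (lt0r_neq0 n0)); rewrite mulr0.
      transitivity (n.1 * dot n (P i - P e) - n.2 * cross n (P i - P e)).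
        by rewrite /dot /cross /=; ring.
      by rewrite h1 h2 !mulr0 subrr.
    transitivity (n.2 * dot n (P i - P e) + n.1 * cross n (P i - P e)).
      by rewrite /dot /cross /=; ring.
    by rewrite h1 h2 !mulr0 addr0.
  by rewrite subr_eq0 => /eqP.
rewrite -(pmulr_rgt0 _ n0).
have -> : dot n n * dot (P e - p) (P i - P e) =
    nu e * (nu i - nu e) + mu e * (mu i - mu e).
  by rewrite /nu /mu /dot /cross /=; ring.
rewrite -mui -mue si.
have -> : nu e * (nu i - nu e) + s i * nu e * (s i * nu i - s i * nu e) =
   (nu e * (nu i - nu e)) * (1 + s i ^+ 2) by ring.
by rewrite !mulr_gt0 ?subr_gt0 // ltr_pwDl // sqr_ge0.
Qed.

Lemma left_rev a b i : (i \in left P b a) = (orient (P a) (P b) (P i) < 0).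
Proof. by rewrite inE orient_swap -orient_cyc oppr_gt0. Qed.

Lemma left_right a b : a != b -> (#|left P a b| + #|left P b a|)%N = 5%N.
Proof.
move=> ab; have dis : [disjoint left P a b & left P b a].
  rewrite -setI_eq0; apply/eqP/setP => i; rewrite finset.in_setI left_rev !inE.
  by apply/negP => /andP[h1 h2]; have := lt_trans h1 h2; rewrite ltxx.
rewrite -cardsUI (disjoint_setI0 dis) cards0 addn0.
have -> : left P a b :|: left P b a = ~: [set a; b]%SET.
  apply/setP => i; rewrite finset.in_setU left_rev !inE negb_or.
  have [->|ia] /= := eqVneq i a; first by rewrite orient_abb ltxx.
  have [->|ib] /= := eqVneq i b; first by rewrite orient_aba ltxx.
  have /generic_orient : uniq [:: b; a; i].
    by rewrite /= !inE negb_or eq_sym ab ![_ == i]eq_sym ia ib.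
  by rewrite neq_lt.
by apply/eqP; rewrite -(eqn_add2l #|[set a; b]%SET|) cardsC cI cards2 ab.
Qed.

Lemma heavy_asym a b : heavy P a b -> ~~ heavy P b a.
Proof.
move=> /andP[ab l2]; apply/negP => /andP[_ r2].
by have := leq_add l2 r2; rewrite left_right.
Qed.

(** From a point of the line beyond an end of the segment, that end would fit [tangent] with the
    closed heavy side as [K]; the other end is the point of [K] on the ray. *)
Lemma center_between a b p : center P p -> heavy P a b ->
  orient (P a) (P b) p = 0 -> p != P a -> p != P b ->
  exists2 t, 0 < t < 1 & p = ((P a).1 + t * (P b - P a).1, (P a).2 + t * (P b - P a).2).
Proof.
move=> cp hab abp pa pb; have /andP[ab l2] := hab.
have Pab : P a != P b by apply: contraNneq ab => /P_inj->.
have b0 : 0 < dot (P b - P a) (P b - P a) by rewrite dot_gt0 // subr_eq0 eq_sym.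
have [t pt] := line_param Pab abp; exists t => //.
have K5 : (5 <= #|~: left P a b|)%N by apply: card_setC_ge l2 _.
have out i : i \in ~: left P a b -> i != a -> i != b -> orient (P a) (P b) (P i) < 0.
  rewrite !inE -leNgt => h ia ib; rewrite lt_neqAle h andbT.
  by apply: generic_orient; rewrite /= !inE negb_or ab ![_ == i]eq_sym ia ib.
have inK i : orient (P a) (P b) (P i) = 0 -> i \in ~: left P a b.
  by move=> h; rewrite !inE h ltxx.
have aK : a \in ~: left P a b by apply: inK; rewrite /orient /cross; ring.
have bK : b \in ~: left P a b by apply: inK; rewrite /orient /cross; ring.
apply/andP; split; rewrite ltNge; apply/negP => ht.
- have {}ht : t < 0.
    rewrite lt_neqAle ht andbT; apply: contraNneq pa => t0.
    by rewrite pt t0; apply/eqP/plane_eq => /=; rewrite mul0r addr0.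
  apply: (@tangent p a (~: left P a b) 1) => //; first by left.
  move=> i iK ia; rewrite mul1r.
  have -> : orient p (P a) (P i) = - t * orient (P a) (P b) (P i).
    by rewrite pt /orient /cross /=; ring.
  have [->|ib] := eqVneq i b; last by left; rewrite pmulr_rlt0 ?out ?oppr_gt0.
  right; split; first by rewrite /orient /cross; ring.
  have -> : dot (P a - p) (P b - P a) = - t * dot (P b - P a) (P b - P a).
    by rewrite pt /dot /=; ring.
  by rewrite mulr_gt0 ?oppr_gt0.
- have {}ht : 1 < t.
    rewrite lt_neqAle ht andbT; apply: contraNneq pb => t1.
    by rewrite pt -t1; apply/eqP/plane_eq => /=; ring.
  apply: (@tangent p b (~: left P a b) (-1)) => //; first by right.
  move=> i iK ib.
  have -> : orient p (P b) (P i) = - (t - 1) * orient (P a) (P b) (P i).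
    by rewrite pt /orient /cross /=; ring.
  have [->|ia] := eqVneq i a.
    right; split; first by rewrite /orient /cross; ring.
    have -> : dot (P b - p) (P a - P b) = (t - 1) * dot (P b - P a) (P b - P a).
      by rewrite pt /dot /=; ring.
    by rewrite mulr_gt0 ?subr_gt0.
  by left; rewrite mulN1r mulNr opprK pmulr_rlt0 ?out ?subr_gt0.
Qed.

(* Otherwise the parallel to xy through p would leave x, y and z strictly on one
   side, together with one of a, b and one of c, d: too many for a central point. *)
Lemma crossing_inside a b c d x y z p (s t : R) : center P p ->
  uniq [:: a; b; c; d; x; y; z] -> 0 < s < 1 -> 0 < t < 1 ->
  p = ((P a).1 + s * (P b - P a).1, (P a).2 + s * (P b - P a).2) ->
  p = ((P c).1 + t * (P d - P c).1, (P c).2 + t * (P d - P c).2) ->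
  0 <= orient (P x) (P y) (P z) * orient (P x) (P y) p.
Proof.
move=> cp un s01 t01 ps pt; rewrite leNgt; apply/negP => neg.
set W := orient (P x) (P y) (P z) in neg.
(* A normal vector of the line [xy], scaled so that [h] is negative at [x], [y] and [z] when [p] and
   [z] are strictly on opposite sides of this line. *)
pose n := (W * (P y - P x).2, - W * (P y - P x).1).
pose h i := dot n (P i - p).
have nE q : dot n (q - p) = W * (orient (P x) (P y) p - orient (P x) (P y) q).
  by rewrite /n /dot /orient /cross /=; ring.
have W0 : 0 < W ^+ 2.
  by rewrite exprn_even_gt0 //=; apply: contraTneq neg => ->; rewrite mul0r ltxx.
(* The function behind [h] vanishes at [p], inside the segment, and differs at the two ends because
   the segment is not parallel to [xy]; so it is negative at one of them. *)
have half i j (r : R) : uniq [:: i; j; x; y] -> 0 < r < 1 ->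
    p = ((P i).1 + r * (P j - P i).1, (P i).2 + r * (P j - P i).2) ->
    exists2 k, k \in [:: i; j] & h k < 0.
  move=> /generic_cross ij /andP[r0 r1] pr.
  have hij : (1 - r) * h i + r * h j = 0.
    by rewrite /h /dot {2 4}pr /= {1 2}pr /=; ring.
  have nz : h i != h j.
    rewrite -subr_eq0; have -> : h i - h j = - (W * cross (P j - P i) (P y - P x)).
      by rewrite /h /n /dot /cross /=; ring.
    by rewrite oppr_eq0 mulf_neq0 // -sqrf_eq0 gt_eqF.
  have [hi|hi] := ltP (h i) 0; first by exists i; rewrite ?inE ?eqxx.
  exists j; first by rewrite !inE eqxx orbT.
  by move: nz; rewrite neq_lt => /orP[]; nra.
have hx : h x < 0.
  by rewrite /h nE orient_aba subr0.
have hy : h y < 0.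
  by rewrite /h nE orient_abb subr0.
have hz : h z < 0.
  by rewrite /h nE -/W mulrBr subr_lt0 (lt_trans neg) // -expr2.
have m := mask_uniq un.
have [k kab hk] := half a b s (m [:: true; true; false; false; true; true]) s01 ps.
have [l lcd hl] := half c d t (m [:: false; false; true; true; true; true]) t01 pt.
apply: (@depth p n cp).
have ukl : uniq [:: k; l; x; y; z].
  move: kab lcd; rewrite !inE => /orP[]/eqP-> /orP[]/eqP->.
  - exact: (m [:: true; false; true; false; true; true; true]).
  - exact: (m [:: true; false; false; true; true; true; true]).
  - exact: (m [:: false; true; true; false; true; true; true]).
  - exact: (m [:: false; true; false; true; true; true; true]).
rewrite -[5%N]/(size [:: k; l; x; y; z]) -(card_uniqP ukl).
apply/subset_leq_card/fintype.subsetP => i; rewrite !inE.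
by move=> /or4P[/eqP->|/eqP->|/eqP->|/orP[]/eqP->].
Qed.

End Center.

(** * Vertices of the centre region *)

Section Vertices.
Variables (R : realType) (I : finType) (P : I -> R * R).
Hypotheses (cI : #|I| = 7%N) (gP : generic P).
Implicit Types (a b c d e f i j : I) (p q u v : R * R) (A K : {set I}).

Lemma continuous_dot u : continuous (fun p : R * R => dot u p).
Proof.
move=> x; apply: cvgD; apply: cvgM; try exact: cvg_cst; [exact: cvg_fst|exact: cvg_snd].
Qed.

Lemma continuous_orient p q : continuous (fun r : R * R => orient p q r).
Proof.
have -> : (fun r : R * R => orient p q r) =
    (fun r => dot (- (q - p).2, (q - p).1) r + (- cross (q - p) p)).
  by apply/funext => r; rewrite /orient /dot /cross /=; ring.
move=> x; apply: cvgD; [exact: continuous_dot|exact: cvg_cst].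
Qed.

Lemma closed_forall_le (T : topologicalType) (J : Type) (D : J -> Prop)
    (g : J -> T -> R) : (forall k, continuous (g k)) ->
  closed [set x | forall k, D k -> g k x <= 0]%classic.
Proof.
move=> cg.
have -> : [set x | forall k, D k -> g k x <= 0]%classic =
    (\bigcap_(k in D) (g k @^-1` [set y | (y <= 0)%R]))%classic.
  by apply/seteqP; split => x /= H k; apply: H.
by apply: closed_bigI => k _; apply: preimage_closed => //; exact: closed_le.
Qed.

(** A coordinate beyond the bound would put all seven points into an open half-plane bounded by a
    line through [p], against [depth]. *)
Lemma center_bounded : exists M, forall p, center P p ->
  (- M <= p.1 <= M) /\ (- M <= p.2 <= M).
Proof.
pose M := \sum_i (`|(P i).1| + `|(P i).2|).
have PM i : `|(P i).1| <= M /\ `|(P i).2| <= M.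
  rewrite /M (bigD1 i) //=; set S := \sum_(_ | _) _.
  have S0 : 0 <= S by apply: sumr_ge0 => j _; rewrite addr_ge0.
  by have := normr_ge0 (P i).1; have := normr_ge0 (P i).2; split; lra.
exists M => p cp; have dp n := @depth _ _ P cI gP p n cp.
have all7 (n : R * R) : (forall i, dot n (P i - p) < 0) -> False.
  move=> H; apply: (dp n).
  have -> : [set i | dot n (P i - p) < 0]%SET = [set: I]%SET.
    by apply/setP => i; rewrite !inE H.
  by rewrite cardsT cI.
have B i : [/\ - M <= (P i).1, (P i).1 <= M, - M <= (P i).2 & (P i).2 <= M].
  by have [] := PM i; rewrite !ler_norml => /andP[? ?] /andP[? ?].
split; apply/andP; split; rewrite leNgt; apply/negP => h.
- by apply: (all7 (-1, 0)) => i; rewrite /dot /=; have [] := B i; lra.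
- by apply: (all7 (1, 0)) => i; rewrite /dot /=; have [] := B i; lra.
- by apply: (all7 (0, -1)) => i; rewrite /dot /=; have [] := B i; lra.
- by apply: (all7 (0, 1)) => i; rewrite /dot /=; have [] := B i; lra.
Qed.

Lemma compact_center : compact [set p | center P p]%classic.
Proof.
have [M HM] := center_bounded.
apply: (@subclosed_compact _ _ (`[- M, M] `*` `[- M, M])%classic).
- have -> : [set p | center P p]%classic =
    [set p | forall t : I * I, heavy P t.1 t.2 -> orient (P t.1) (P t.2) p <= 0]%classic.
    by apply/seteqP; split => p /= H; [move=> t; apply: H|move=> a b; apply: (H (a, b))].
  by apply: closed_forall_le => t; exact: continuous_orient.
- by apply: compact_setX; exact: segment_compact.
- by move=> p /HM /= [? ?]; rewrite !in_itv.
Qed.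

(** Compactness is used twice: first for [u], then for [v] on the face where [u] is maximal. *)
Lemma center_lexmax u v : exists p, [/\ center P p,
  forall q, center P q -> dot u q <= dot u p &
  forall q, center P q -> dot u q = dot u p -> dot v q <= dot v p].
Proof.
have [||p1] := @compact_EVT_max _ _ (dot u) _ _ compact_center.
- by have [p cp] := center_exists P cI; exists p.
- by apply: continuous_subspaceT; exact: continuous_dot.
rewrite inE /= => cp1 max1.
pose F := ([set p | center P p] `&` [set p | dot u p1 <= dot u p])%classic.
have [|||p2] := @compact_EVT_max _ _ (dot v) F.
- by exists p1; split => /=.
- apply: compact_closedI; first exact: compact_center.
  by apply: (@preimage_closed _ _ (dot u)) (@closed_ge _ _) => x _; exact: continuous_dot.
- by apply: continuous_subspaceT; exact: continuous_dot.
rewrite inE => -[/= cp2 p12] max2; exists p2; split => // q cq.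
  by apply: le_trans p12; apply: max1; rewrite inE.
by move=> uq; apply: max2; rewrite inE; split => //=; rewrite uq.
Qed.

Definition vertex a b c d p :=
  [/\ center P p, heavy P a b /\ heavy P c d,
      orient (P a) (P b) p = 0, orient (P c) (P d) p = 0
    & cross (P b - P a) (P d - P c) != 0].

(** Only the heavy lines through [p] restrict the direction of a small move; the other inequalities
    are strict and survive by [eps_neg]. *)
Lemma center_move p u : center P p ->
  (forall a b, heavy P a b -> orient (P a) (P b) p = 0 -> cross (P b - P a) u <= 0) ->
  exists2 e, 0 < e & center P (p.1 + e * u.1, p.2 + e * u.2).
Proof.
move=> cp H.
have [e e0 He] := eps_neg (fun t : I * I => orient (P t.1) (P t.2) p)
  (fun t => cross (P t.2 - P t.1) u).
exists e => // a b hab; rewrite orient_move.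
have := cp a b hab; rewrite le_eqVlt => /predU1P[ab0|/(He (a, b))/= h].
  by rewrite ab0 add0r pmulr_rle0 //; exact: H.
by apply: ltW; apply: le_lt_trans h; rewrite lerD2l ler_pM2l // ler_norm.
Qed.

(** If the heavy lines through a lexicographic maximum were all parallel, one could move both ways
    along their direction [w]; maximality would make [w] orthogonal to [u] and to [v], hence
    zero. *)
Lemma lexmax_vertex u v : cross u v != 0 -> exists p,
  [/\ exists a b c d, vertex a b c d p,
      forall q, center P q -> dot u q <= dot u p &
      forall q, center P q -> dot u q = dot u p -> dot v q <= dot v p].
Proof.
move=> uv; have [p [cp max1 max2]] := center_lexmax u v; exists p; split => //.
apply: contrapT => nv.
have par a b c d : heavy P a b -> heavy P c d -> orient (P a) (P b) p = 0 ->
    orient (P c) (P d) p = 0 -> cross (P b - P a) (P d - P c) = 0.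
  move=> ab cd abp cdp; apply/eqP; apply: contraT => nz.
  by case: nv; exists a, b, c, d; split.
have [w w0 Hw] : exists2 w : R * R, w != 0 & forall a b, heavy P a b ->
    orient (P a) (P b) p = 0 -> cross (P b - P a) w = 0.
  have [[a [b [ab abp]]]|none] := pselect (exists a b, heavy P a b /\
      orient (P a) (P b) p = 0).
    exists (P b - P a); last by move=> c d cd cdp; apply: par.
    have /andP[nab _] := ab.
    by rewrite subr_eq0; apply: contraNneq nab => /(P_inj cI gP)->.
  (* Without a heavy line through [p], any nonzero direction will do. *)
  exists (1, 0); last by move=> a b ab abp; case: none; exists a, b.
  by apply/eqP => -[/eqP]; rewrite oner_eq0.
have Hw' a b : heavy P a b -> orient (P a) (P b) p = 0 -> cross (P b - P a) (- w) = 0.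
  move=> ab abp; have := Hw a b ab abp; rewrite /cross /= => h.
  by rewrite !mulrN -opprD -[RHS]oppr0 -h; congr (- _); ring.
have [|e e0 ce] := @center_move _ w cp; first by move=> a b ab abp; rewrite Hw.
have [|e' e'0 ce'] := @center_move _ (- w) cp; first by move=> a b ab abp; rewrite Hw'.
have D x t y : dot x (p.1 + t * y.1, p.2 + t * y.2) = dot x p + t * dot x y.
  by rewrite /dot /=; ring.
have dN x : dot x (- w) = - dot x w by rewrite /dot /=; ring.
have uw : dot u w = 0.
  move: (max1 _ ce) (max1 _ ce'); rewrite !D dN !gerDl mulrN oppr_le0.
  by rewrite pmulr_rle0 // pmulr_rge0 // => h1 h2; apply/eqP; rewrite eq_le h1 h2.
have vw : dot v w = 0.
  move: (max2 _ ce) (max2 _ ce'); rewrite !D !dN uw oppr0 !mulr0 addr0.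
  move=> /(_ erefl) + /(_ erefl); rewrite !gerDl mulrN oppr_le0.
  by rewrite pmulr_rle0 // pmulr_rge0 // => h1 h2; apply/eqP; rewrite eq_le h1 h2.
move/eqP: w0; apply; apply: plane_eq => /=; apply: (mulfI uv); rewrite mulr0.
  transitivity (dot u w * v.2 - dot v w * u.2); first by rewrite /cross /dot; ring.
  by rewrite uw vw !mul0r subrr.
transitivity (dot v w * u.1 - dot u w * v.1); first by rewrite /cross /dot; ring.
by rewrite uw vw !mul0r subrr.
Qed.

End Vertices.

(** * Edges of the centre region *)

Section Partitions.
Variables (R : realType) (I : finType) (P : I -> R * R).
Hypotheses (cI : #|I| = 7%N) (gP : generic P).
Implicit Types (a b c d e f g i j : I) (p q u v : R * R) (A B K : {set I}).
Implicit Type Q : {set {set I}}.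

Lemma vertexC a b c d p : vertex P a b c d p -> vertex P c d a b p.
Proof.
move=> [cp [ab cd] abp cdp nz]; split => //.
by apply: contraNneq nz => h; rewrite -oppr_eq0 -h /cross; apply/eqP; ring.
Qed.

(** An index shared by the two pairs would name a point on both lines, which would then be [p]. *)
Lemma vertex_uniq a b c d p : vertex P a b c d p -> (forall i, p != P i) ->
  uniq [:: a; b; c; d].
Proof.
move=> [_ [/andP[ab _] /andP[cd _]] abp cdp nz] pX.
have meet i : orient (P a) (P b) (P i) = 0 -> orient (P c) (P d) (P i) = 0 -> False.
  by move=> h1 h2; have := pX i; rewrite (lines_meet_once nz abp cdp h1 h2) eqxx.
have ma := meet a (orient_aba _ _); have mb := meet b (orient_abb _ _).
rewrite /= !inE !negb_or ab cd /= !andbT -!andbA; apply/and4P; split; apply/eqP => E.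
- by apply: ma; rewrite E orient_aba.
- by apply: ma; rewrite E orient_abb.
- by apply: mb; rewrite E orient_aba.
- by apply: mb; rewrite E orient_abb.
Qed.

(** Disjoint pairs are not parallel in general position, so the second pair is on the line [ab]
    itself. This line carries just two of the points, and [heavy_asym] excludes the reversed
    pair. *)
Lemma heavy_parallel a b c d : heavy P a b -> heavy P c d ->
  cross (P b - P a) (P d - P c) = 0 -> (c, d) = (a, b).
Proof.
move=> hab hcd par; have /andP[ab _] := hab; have /andP[cd _] := hcd.
have three i : orient (P a) (P b) (P i) = 0 -> i = a \/ i = b.
  move=> h; apply: contrapT => /not_orP[/eqP ia /eqP ib].
  have /(generic_orient gP)/eqP : uniq [:: a; b; i].
    by rewrite /= !inE negb_or ab ![_ == i]eq_sym ia ib.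
  exact.
have shift : orient (P a) (P b) (P c) = orient (P a) (P b) (P d).
  by apply/eqP; rewrite eq_sym -subr_eq0 -par; apply/eqP; rewrite /orient /cross /=; ring.
have [hc|hc] := eqVneq (orient (P a) (P b) (P c)) 0.
  have hd := hc; rewrite shift in hd.
  have [Ec|Ec] := three c hc; have [Ed|Ed] := three d hd; rewrite Ec Ed // in cd hcd *.
  - by rewrite eqxx in cd.
  - by have := heavy_asym cI gP hab; rewrite hcd.
  - by rewrite eqxx in cd.
have /(generic_cross gP) : uniq [:: a; b; c; d].
  have N i : orient (P a) (P b) (P i) != 0 -> (a != i) && (b != i).
    by move=> h; apply/andP; split; apply: contraNneq h => <-; rewrite ?orient_aba ?orient_abb.
  have /andP[? ?] := N c hc; rewrite shift in hc; have /andP[? ?] := N d hc.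
  by rewrite /= !inE !negb_or; do !(apply/andP; split).
by rewrite par eqxx.
Qed.

(** A heavy line through the vertex and different from both would be parallel to neither, so by
    [vertex_uniq] the six indices would be distinct and the three lines concurrent. *)
Lemma third_line a b c d e f p : vertex P a b c d p -> (forall i, p != P i) ->
  heavy P e f -> orient (P e) (P f) p = 0 -> (e, f) = (a, b) \/ (e, f) = (c, d).
Proof.
move=> V pX ef efp; have [cp [ab cd] abp cdp nz] := V.
have [/(heavy_parallel ab ef)|n1] := eqVneq (cross (P b - P a) (P f - P e)) 0; first by left.
have [/(heavy_parallel cd ef)|n2] := eqVneq (cross (P d - P c) (P f - P e)) 0; first by right.
have u1 := vertex_uniq V pX.
have /vertex_uniq/(_ pX) u2 : vertex P a b e f p by split.
have /vertex_uniq/(_ pX) u3 : vertex P c d e f p by split.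
have /(generic_concur gP)/eqP[] : uniq [:: a; b; c; d; e; f].
  move: u1 u2 u3; rewrite /= !inE !negb_or -!andbA !andbT.
  by do 3!move=> /and5P[? ? ? ? /andP[? ?]]; do !(apply/andP; split).
apply: concur_eq0 abp cdp efp; have /andP[n _] := ab.
by apply: contraNneq n => /(P_inj cI gP)->.
Qed.

(** The other end of the edge on the line [ab]: the maximum of [n] over the centre region is
    attained along this edge, and [u] then selects its end away from the line [cd]. *)
Lemma walk a b c d p : vertex P a b c d p -> (forall i, p != P i) ->
  exists q e f, vertex P a b e f q /\ q != p.
Proof.
move=> V pX; have [cp [ab cd] abp cdp nz] := V.
pose w := P b - P a; pose k := cross w (P d - P c).
(* The factor [k] directs [u] along [ab] into the half-plane of [cd], and [n] is the normal of [ab]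
   towards its light side. *)
pose u := (k * w.1, k * w.2); pose n := (- w.2, w.1).
have w0 : 0 < dot w w.
  by apply: dot_gt0; apply: contraNneq nz; rewrite -/w => ->; rewrite /cross !mul0r subrr.
have k2 : 0 < k ^+ 2 by rewrite exprn_even_gt0.
have [|e e0 ce] := @center_move _ _ P p u cp.
  move=> i j ij ijp; have [[-> ->]|[-> ->]] := third_line V pX ij ijp.
    by rewrite -/w (_ : cross w u = 0) // /u /cross /=; ring.
  by rewrite (_ : cross _ u = - k ^+ 2) ?oppr_le0 ?ltW // /u /k /w /cross /=; ring.
have nu : cross n u != 0.
  have -> : cross n u = - (k * dot w w) by rewrite /n /u /cross /dot /=; ring.
  by rewrite oppr_eq0 mulf_neq0 // gt_eqF.
have [q [[a1 [b1 [c1 [d1 V1]]]] max1 max2]] := lexmax_vertex cI gP nu.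
have [cq [ab1 cd1] abq cdq nz1] := V1.
have nE x : dot n x = orient (P a) (P b) x + cross w (P a).
  by rewrite /n /orient /dot /cross /w /=; ring.
have abq0 : orient (P a) (P b) q = 0.
  apply/eqP; rewrite eq_le cq //=.
  by have := max1 p cp; rewrite !nE lerD2r abp.
have uqp : dot u p < dot u q.
  apply: (lt_le_trans _ (max2 _ ce _)).
    have -> : dot u (p.1 + e * u.1, p.2 + e * u.2) = dot u p + e * (k ^+ 2 * dot w w).
      by rewrite /u /dot /=; ring.
    by rewrite ltrDl mulr_gt0 // mulr_gt0.
  rewrite !nE orient_move abp abq0 -/w; congr (_ + _).
  by rewrite /u /cross /=; ring.
have qp : q != p by apply: contraTneq uqp => ->; rewrite ltxx.
(* Of the two heavy lines found at [q], one that is not [ab] is returned. *)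
have [h|h] := eqVneq (cross w (P d1 - P c1)) 0; last by exists q, c1, d1.
have [Ec Ed] := heavy_parallel ab cd1 h.
exists q, a1, b1; split => //; split => //; rewrite -Ec -Ed.
by have [] := vertexC V1.
Qed.

(** [p] is interior to the segment from [P c] to [P d], whose ends therefore lie strictly on
    opposite sides of the line [ab]. *)
Lemma straddle a b c d p : vertex P a b c d p -> (forall i, p != P i) ->
  exists2 k, k \in [:: c; d] & k \in left P a b.
Proof.
move=> V pX; have [cp [ab cd] abp cdp nz] := V.
have [t /andP[t0 t1] pt] := center_between cI gP cp cd cdp (pX c) (pX d).
have un := vertex_uniq V pX.
have nc := generic_orient gP (mask_uniq un [:: true; true; true]).
have E : (1 - t) * orient (P a) (P b) (P c) + t * orient (P a) (P b) (P d) = 0.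
  by rewrite -abp pt /orient /cross /=; ring.
move: nc; rewrite neq_lt => /orP[h|h]; last by exists c; rewrite !inE ?eqxx.
exists d; first by rewrite !inE eqxx orbT.
rewrite inE -(pmulr_rgt0 _ t0); move: E => /eqP; rewrite addrC addr_eq0 => /eqP->.
by rewrite oppr_gt0 pmulr_rlt0 // subr_gt0.
Qed.

(** [i] and [j] already exhaust the light side. *)
Lemma heavy_third a b i j k : heavy P a b -> uniq [:: k; i; j] ->
  i \in left P a b -> j \in left P a b -> orient (P a) (P b) (P k) <= 0.
Proof.
move=> /andP[_ l2] un iL jL; rewrite leNgt; apply/negP => kL.
have : (3 <= #|left P a b|)%N.
  rewrite -[3%N]/(size [:: k; i; j]) -(card_uniqP un).
  apply/subset_leq_card/fintype.subsetP => x; rewrite !inE.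
  by move: iL jL; rewrite !inE => iL jL /or3P[] /eqP->.
by rewrite ltnNge l2.
Qed.

(* The seventh point lies on the inner side of the three heavy lines, hence in the
   triangle they form. *)
Lemma triangle_center a b c d e f p q r : vertex P a b c d p ->
  vertex P a b e f q -> vertex P c d e f r -> (forall i, p != P i) ->
  (forall i, q != P i) -> (forall i, r != P i) -> exists g, center P (P g).
Proof.
move=> V1 V2 V3 pX qX rX.
have u1 := vertex_uniq V1 pX; have u2 := vertex_uniq V2 qX; have u3 := vertex_uniq V3 rX.
have [g _] : exists2 g, g \in [set: I]%SET & g \notin [:: a; b; c; d; e; f].
  by apply: pick_other; rewrite // cardsT cI.
rewrite !inE !negb_or => /and5P[ga gb gc gd /andP[ge gf]].
have [cp [ab cd] abp cdp nz1] := V1; have [cq [_ ef] abq efq nz2] := V2.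
have [cr _ cdr efr nz3] := V3.
have un6 (x y z w : I) : uniq [:: g; x; y; z; w] ->
    forall k l, k \in [:: x; y] -> l \in [:: z; w] -> uniq [:: g; k; l].
  move=> un k l; rewrite !inE => /orP[]/eqP-> /orP[]/eqP->.
  - exact: (mask_uniq un [:: true; true; false; true]).
  - exact: (mask_uniq un [:: true; true; false; false; true]).
  - exact: (mask_uniq un [:: true; false; true; true]).
  - exact: (mask_uniq un [:: true; false; true; false; true]).
have gn (x y z w : I) : g != x -> g != y -> g != z -> g != w ->
    uniq [:: x; y; z; w] -> uniq [:: g; x; y; z; w].
  by move=> h1 h2 h3 h4 u; rewrite cons_uniq u !inE !negb_or h1 h2 h3 h4.
have g1 := un6 _ _ _ _ (gn _ _ _ _ ga gb gc gd u1).
have g2 := un6 _ _ _ _ (gn _ _ _ _ ga gb ge gf u2).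
have g3 := un6 _ _ _ _ (gn _ _ _ _ gc gd ge gf u3).
(* The segments [cd] and [ef] cross the line [ab] at [p] and [q], and their left ends fill its light
   side. *)
have abg : orient (P a) (P b) (P g) <= 0.
  have [x x1 x2] := straddle V1 pX; have [y y1 y2] := straddle V2 qX.
  exact: (heavy_third ab (g3 x y x1 y1)).
have cdg : orient (P c) (P d) (P g) <= 0.
  have [x x1 x2] := straddle (vertexC V1) pX; have [y y1 y2] := straddle V3 rX.
  exact: (heavy_third cd (g2 x y x1 y1)).
have efg : orient (P e) (P f) (P g) <= 0.
  have [x x1 x2] := straddle (vertexC V2) qX; have [y y1 y2] := straddle (vertexC V3) rX.
  exact: (heavy_third ef (g1 x y x1 y1)).
have neg i j x y z w t : vertex P x y z w t -> (forall i, t != P i) -> heavy P i j ->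
    (i, j) <> (x, y) -> (i, j) <> (z, w) -> orient (P i) (P j) t < 0.
  move=> V tX ij n1 n2; rewrite lt_neqAle; have [-> // _ _ _ _] := V; rewrite andbT.
  by apply/eqP => h; case: (third_line V tX ij h).
have self x y z w : cross (P y - P x) (P w - P z) != 0 -> (z, w) <> (x, y).
  move=> h [E1 E2]; move: h; rewrite E1 E2 /cross.
  by rewrite [X in _ - X]mulrC subrr eqxx.
have efp := neg e f _ _ _ _ _ V1 pX ef (self _ _ _ _ nz2) (self _ _ _ _ nz3).
have cdq := neg c d _ _ _ _ _ V2 qX cd (self _ _ _ _ nz1)
  (fun h => self _ _ _ _ nz3 (esym h)).
have abr := neg a b _ _ _ _ _ V3 rX ab (fun h => self _ _ _ _ nz1 (esym h))
  (fun h => self _ _ _ _ nz2 (esym h)).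
pose W := orient p q r.
have W0 : W != 0.
  (* Were [p], [q], [r] collinear, [orient_bary] would make [orient z q r] vanish for all [z], so
     that [q = r]; but [r] is on the line [cd] and [q] is not. *)
  apply/eqP => W0.
  have qr z : orient z q r = 0.
    have := orient_bary (P e) (P f) p q r z.
    rewrite -/W W0 mulr0 efq efr !mul0r !addr0 => /esym/eqP; rewrite mulf_eq0.
    by rewrite (lt_eqF efp) => /eqP.
  have Eqr : q = r.
    apply: plane_eq.
    - have := qr (q.1, q.2 + 1); rewrite orient_cyc /orient /cross /= => h.
      by apply/eqP; rewrite eq_sym -subr_eq0 -h; apply/eqP; ring.
    - have := qr (q.1 - 1, q.2); rewrite orient_cyc /orient /cross /= => h.
      by apply/eqP; rewrite eq_sym -subr_eq0 -h; apply/eqP; ring.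
  by move: cdq; rewrite Eqr cdr ltxx.
have bary i j := orient_bary (P i) (P j) p q r (P g).
have W2 : 0 < W ^+ 2 by rewrite exprn_even_gt0.
have sgn (x y h : R) : x * W = y * h -> x <= 0 -> y < 0 -> 0 <= W * h.
  move=> E x0 y0; rewrite -(nmulr_rle0 _ y0) mulrCA -E mulrCA -expr2.
  by rewrite mulr_le0_ge0 // ltW.
exists g => i j ij.
have := bary e f; rewrite efq efr !mul0r !addr0 -/W => /sgn/(_ efg efp) hp.
have := bary c d; rewrite cdp cdr !mul0r add0r addr0 -/W => /sgn/(_ cdg cdq) hq.
have := bary a b; rewrite abp abq !mul0r !add0r -/W => /sgn/(_ abg abr) hr.
(* Up to the factor [W ^+ 2], the value at [P g] is a combination of those at [p], [q] and [r], with
   weights that are non-negative by [hp], [hq] and [hr]. *)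
rewrite -(pmulr_rle0 _ W2) expr2 -mulrA [W * orient _ _ _]mulrC bary.
have dist (x y z x' y' z' : R) :
    W * (x * x' + y * y' + z * z') = x * (W * x') + y * (W * y') + z * (W * z').
  ring.
have le0 (x y : R) : x <= 0 -> 0 <= W * y -> x * (W * y) <= 0 by apply: mulr_le0_ge0.
have add0 (x y : R) : x <= 0 -> y <= 0 -> x + y <= 0 by lra.
rewrite dist; exact: (add0 _ _ (add0 _ _ (le0 _ _ (cp _ _ ij) hp)
  (le0 _ _ (cq _ _ ij) hq)) (le0 _ _ (cr _ _ ij) hr)).
Qed.

End Partitions.

(** * Tverberg partitions *)

Section Tverberg.
Variables (R : realType) (I : finType) (P : I -> R * R).
Implicit Types (a b c d e f g i j : I) (p q u v : R * R) (A B K : {set I}).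
Implicit Type Q : {set {set I}}.

Definition tverberg Q p := [/\ finset.partition Q [set: I]%SET, #|Q| = 3%N
  & forall A, A \in Q -> in_hull P A p].

Definition parts3 A B : {set {set I}} := [set A; B; ~: (A :|: B)]%SET.

Lemma parts3P A B p : A != finset.set0 -> B != finset.set0 ->
  ~: (A :|: B) != finset.set0 -> [disjoint A & B] ->
  in_hull P A p -> in_hull P B p -> in_hull P (~: (A :|: B)) p ->
  tverberg (parts3 A B) p.
Proof.
set C := ~: _ => A0 B0 C0 AB hA hB hC.
have AC : [disjoint A & C].
  by rewrite finset.disjoints_subset finset.setCK finset.subsetUl.
have BC : [disjoint B & C].
  by rewrite finset.disjoints_subset finset.setCK finset.subsetUr.
have neq (X Y : {set I}) : X != finset.set0 -> [disjoint X & Y] -> X != Y.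
  move=> X0; apply: contraTneq => <-; rewrite -setI_eq0 finset.setIid.
  exact: X0.
have AnB := neq _ _ A0 AB; have AnC := neq _ _ A0 AC; have BnC := neq _ _ B0 BC.
split.
- apply/and3P; split.
  + apply/eqP/setP => i; rewrite !inE /finset.cover.
    apply/finset.bigcupP; have [iA|iA] := boolP (i \in A).
      by exists A; rewrite // !inE eqxx.
    have [iB|iB] := boolP (i \in B).
      by exists B; rewrite // !inE eqxx orbT.
    exists C; first by rewrite !inE eqxx orbT.
    by rewrite !inE negb_or iA iB.
  + apply/finset.trivIsetP => X Y; rewrite !inE -!orbA.
    move=> /or3P[]/eqP-> /or3P[]/eqP->; rewrite ?eqxx // => _;
    by rewrite // disjoint_sym.
  + by rewrite !inE !negb_or ![finset.set0 == _]eq_sym A0 B0 C0.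
- by rewrite /parts3 -finset.setUA cardsU1 cards2 !inE negb_or AnB AnC BnC.
- by move=> X; rewrite !inE -orbA => /or3P[]/eqP->.
Qed.

Lemma in_hullS A B p : A \subset B -> in_hull P A p -> in_hull P B p.
Proof.
move=> /fintype.subsetP AB [w [w0 wA w1 pw]]; exists w; split => // i iB.
by apply: wA; apply: contraNN iB; exact: AB.
Qed.

Lemma in_hull1P a p : in_hull P [set a]%SET p -> p = P a.
Proof.
move=> [w [_ wa w1 ->]].
have S (h : I -> R) : \sum_i w i * h i = w a * h a.
  by rewrite (bigD1 a) //= big1 ?addr0 // => i ia; rewrite wa ?mul0r // !inE.
have : \sum_i w i * 1 = 1 by rewrite -[RHS]w1; apply: eq_bigr => i _; rewrite mulr1.
by rewrite S mulr1 => wa1; apply: plane_eq => /=; rewrite S wa1 mul1r.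
Qed.

Definition crossing Q p := tverberg Q p /\ exists a b c d,
  [/\ uniq [:: a; b; c; d], [set a; b]%SET \in Q & [set c; d]%SET \in Q].

Hypotheses (cI : #|I| = 7%N) (gP : generic P).

(** Two of the parts are pairs whose lines are not parallel, so the common point is unique. Hence
    different points give different partitions. *)
Lemma crossing_point Q p q : crossing Q p -> tverberg Q q -> p = q.
Proof.
move=> [[_ _ hp] [a [b [c [d [un abQ cdQ]]]]]] [_ _ hq].
have col x y z : in_hull P [set x; y]%SET z -> orient (P x) (P y) z = 0.
  move=> /in_hull_orient; apply => i; rewrite !inE => /orP[]/eqP->.
    exact: orient_aba.
  exact: orient_abb.
by apply: (lines_meet_once (generic_cross gP un)); apply: col; auto.
Qed.

(** The two segments meet at [p] by [center_between]; the three other points form the third part,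
    and [crossing_inside] for each of its sides puts [p] into their triangle. *)
Lemma vertex_crossing a b c d p : vertex P a b c d p -> (forall i, p != P i) ->
  exists Q, crossing Q p.
Proof.
move=> V pX; have [cp [ab cd] abp cdp nz] := V.
have un := vertex_uniq V pX.
have [t t01 pt] := center_between cI gP cp ab abp (pX a) (pX b).
have [s s01 ps] := center_between cI gP cp cd cdp (pX c) (pX d).
have ext (l : seq I) : (size l < 7)%N -> uniq l -> exists i, uniq (rcons l i).
  move=> l7 ul; have [|i _ il] := @pick_other _ [set: I]%SET l; first by rewrite cardsT cI.
  by exists i; rewrite rcons_uniq il.
have [x ux] := ext [:: a; b; c; d] isT un.
have [y uy] := ext (rcons [:: a; b; c; d] x) isT ux.
have [z un7] := ext (rcons (rcons [:: a; b; c; d] x) y) isT uy.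
rewrite -[rcons _ z]/[:: a; b; c; d; x; y; z] in un7.
have tri x' y' z' : perm_eq [:: x; y; z] [:: x'; y'; z'] ->
    0 <= orient (P x') (P y') (P z') * orient (P x') (P y') p.
  move=> xyz; apply: (crossing_inside cI gP cp _ t01 s01 pt ps).
  rewrite (_ : [:: a; b; c; d; x'; y'; z'] = [:: a; b; c; d] ++ [:: x'; y'; z']) //.
  by rewrite -(perm_uniq (perm_cat (perm_refl _) xyz)).
have uz : uniq [:: x; y; z] by apply: (mask_uniq un7 (nseq 4 false ++ nseq 3 true)).
have rotP n : perm_eq [:: x; y; z] (rot n [:: x; y; z]) by rewrite perm_sym perm_rot.
have hz : in_hull P [set x; y; z]%SET p.
  apply: in_hull_triangle.
  - exact: generic_orient.
  - exact: tri.
  - by rewrite orient_cyc; apply: tri; exact: (rotP 1).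
  - by rewrite -(orient_cyc (P z)); apply: tri; exact: (rotP 2).
exists (parts3 [set a; b]%SET [set c; d]%SET); split; last first.
  by exists a, b, c, d; split; rewrite // !inE eqxx ?orbT.
have sub : [set x; y; z]%SET \subset ~: ([set a; b] :|: [set c; d])%SET.
  apply/fintype.subsetP => i iz; rewrite !inE -!orbA.
  apply/negP => ia; move: un7.
  rewrite -[X in uniq X]/([:: a; b; c; d] ++ [:: x; y; z]) cat_uniq => /and3P[_ /hasPn H _].
  by have := H i; rewrite !inE -orbA in iz *; rewrite iz => /(_ isT)/negP; apply.
apply: parts3P.
- by apply/finset.set0Pn; exists a; rewrite !inE eqxx.
- by apply/finset.set0Pn; exists c; rewrite !inE eqxx.
- by apply/finset.set0Pn; exists x; apply: (fintype.subsetP sub); rewrite !inE eqxx.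
- rewrite finset.disjoints_subset; apply/fintype.subsetP => i; rewrite !inE.
  move: un; rewrite -[X in uniq X]/([:: a; b] ++ [:: c; d]) cat_uniq => /and3P[_ /hasPn H _].
  by apply: contraTN => icd; have := H i; rewrite !inE icd => /(_ isT).
- rewrite pt; apply: in_hull_segment; have /andP[t0 t1] := t01.
  by rewrite (ltW t0) ltW.
- rewrite ps; apply: in_hull_segment; have /andP[t0 t1] := s01.
  by rewrite (ltW t0) ltW.
- exact: in_hullS sub hz.
Qed.

End Tverberg.

(** * Six points around a central one *)

Section Tournaments.

Definition pairs6 : seq (nat * nat) :=
  [seq p <- [seq (j, k) | j <- iota 0 6, k <- iota 0 6] | (p.1 < p.2)%N].

(** The adjacency matrix of a tournament on six vertices, from its fifteen entries above the
    diagonal, row by row as in [pairs6]. *)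
Definition beats_table (l : seq bool) : seq (seq bool) :=
  if l is [:: a; b; c; d; e; f; g; h; i; j; k; m; n; o; p] then
    [:: [:: false; a; b; c; d; e];
        [:: ~~ a; false; f; g; h; i];
        [:: ~~ b; ~~ f; false; j; k; m];
        [:: ~~ c; ~~ g; ~~ j; false; n; o];
        [:: ~~ d; ~~ h; ~~ k; ~~ n; false; p];
        [:: ~~ e; ~~ i; ~~ m; ~~ o; ~~ p; false]]
  else [::].

Definition beats (t : seq (seq bool)) (j k : nat) : bool := nth false (nth [::] t j) k.

Definition score (s : rel nat) (j : nat) : nat := count (s j) (iota 0 6).

(** A line through a central point and one of the six others leaves two or three of the five
    remaining points on either side. *)
Definition balanced (s : rel nat) : bool :=
  all (fun j => score s j \in [:: 2; 3]%N) (iota 0 6).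

Definition cyclic3 (s : rel nat) (a b c : nat) : bool :=
  s a b && s b c && s c a || s a c && s c b && s b a.

(** The points to the left of a ray lie in an open half-plane, so three of them cannot surround its
    origin. As balanced scores are at most 3, only lists of length three contain a triple. *)
Definition locally_transitive (s : rel nat) : bool :=
  all (fun a => if [seq b <- iota 0 6 | s a b] is [:: b; c; d] then ~~ cyclic3 s b c d
    else true) (iota 0 6).

(* The pair (j, k) encodes the splitting of {0, ..., 5} into {0, j, k} and the rest. *)
Definition splits : seq (nat * nat) := [seq p <- pairs6 | (0 < p.1)%N].

Definition split_rest (p : nat * nat) : seq nat :=
  [seq i <- iota 1 5 | i \notin [:: p.1; p.2]].

Definition cyclic_split (s : rel nat) (p : nat * nat) : bool :=
  cyclic3 s 0 p.1 p.2 &&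
  (let r := split_rest p in cyclic3 s (nth 0 r 0) (nth 0 r 1) (nth 0 r 2))%N.

(* Through the centre, the line to z is heavy if z has score 2 and the reversed line if
   z has score 3, so y is a direction in which no heavy line is crossed. *)
Definition wedge_dir (s : rel nat) (y : nat) : bool :=
  all (fun z => (z == y) || (if score s z == 3%N then s z y else ~~ s z y)) (iota 0 6).

(** The alternative to four splittings is a direction in which the centre region extends beyond the
    central point. *)
Definition many_splits (s : rel nat) : bool :=
  let n := count (cyclic_split s) splits in
  (2 <= n)%N && ((4 <= n)%N || has (wedge_dir s) (iota 0 6)).

(** A recursion on the bits, so that the list of all cases is never built. *)
Fixpoint forall_bits n (p : pred (seq bool)) : bool :=
  if n is m.+1 then forall_bits m (fun l => p (true :: l)) &&
    forall_bits m (fun l => p (false :: l)) else p [::].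

Lemma forall_bitsP n p l : forall_bits n p -> size l = n -> p l.
Proof.
elim: n p l => [|n IH] p [|b l] //= /andP[h1 h2] [sl].
by case: b; [apply: (IH _ _ h1 sl)|apply: (IH _ _ h2 sl)].
Qed.

(** An exhaustive check of the 2^15 tournaments. *)
Lemma tournament_splits l : size l = 15%N ->
  let s := beats (beats_table l) in
  balanced s -> locally_transitive s -> many_splits s.
Proof.
pose p l := let s := beats (beats_table l) in
  if balanced s then if locally_transitive s then many_splits s else true else true.
(* Conditionals rather than ==>, whose arguments the virtual machine evaluates eagerly. *)
move=> sl s hb ht; have : p l.
  by apply: forall_bitsP sl; vm_cast_no_check (erefl true).
by rewrite /p -/s hb ht.
Qed.

Lemma splits_inj p q : p \in splits -> q \in splits ->
  {in iota 0 6, [:: 0; p.1; p.2]%N =i [:: 0; q.1; q.2]%N} -> p = q.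
Proof.
have H : all (fun p => all (fun q => all (fun m =>
    (m \in [:: 0; p.1; p.2]%N) == (m \in [:: 0; q.1; q.2]%N)) (iota 0 6) ==> (p == q))
    splits) splits by vm_compute.
move=> ps qs E; apply/eqP; move/allP: H => /(_ p ps)/allP/(_ q qs)/implyP; apply.
by apply/allP => m m6; rewrite E.
Qed.

Lemma beatsE (r : rel nat) j k : (forall j k, (j < 6)%N -> (k < 6)%N ->
    r k j = (j != k) && ~~ r j k) -> (j < 6)%N -> (k < 6)%N ->
  beats (beats_table [seq r p.1 p.2 | p <- pairs6]) j k = r j k.
Proof.
move=> hr; rewrite /beats /beats_table.
have -> : [seq r p.1 p.2 | p <- pairs6] = [:: r 0 1; r 0 2; r 0 3; r 0 4; r 0 5;
  r 1 2; r 1 3; r 1 4; r 1 5; r 2 3; r 2 4; r 2 5; r 3 4; r 3 5; r 4 5]%N by [].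
by case: j => [|[|[|[|[|[|//]]]]]] _; case: k => [|[|[|[|[|[|//]]]]]] _ //=;
  rewrite [RHS]hr.
Qed.

End Tournaments.

(** * Partitions with a central point as a part *)

Section PointInCenter.
Variables (R : realType) (I : finType) (P : I -> R * R).
Hypotheses (cI : #|I| = 7%N) (gP : generic P).
Implicit Types (K : {set I}) (Q : {set {set I}}).

(** With fewer than two points on one side, at least five of those other than [o] would lie on the
    other closed side, [z] among them, and [z] would fit [tangent] seen from [P o]. *)
Lemma center_left_ge2 o z : center P (P o) -> o != z ->
  (2 <= #|left P o z|)%N /\ (2 <= #|left P z o|)%N.
Proof.
move=> co oz.
have nPoz : P o != P z by apply: contraNneq oz => /(P_inj cI gP)->.
have main K (sg : R) : sg = 1 \/ sg = -1 -> z \notin K ->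
    (forall i, i \notin K -> sg * orient (P o) (P z) (P i) <= 0) -> (2 <= #|K|)%N.
  move=> hsg zK HK; rewrite ltnNge; apply/negP => K1.
  have K5 : (5 <= #|~: (o |: K)|)%N.
    by apply: (@card_setC_ge _ cI _ 2) => //; rewrite cardsU1; exact: leq_add (leq_b1 _) K1.
  apply: (@tangent _ _ P cI gP (P o) z (~: (o |: K)) sg co) => //.
    by rewrite !inE negb_or eq_sym oz.
  move=> i; rewrite !inE negb_or => /andP[io iK] iz; left.
  rewrite lt_neqAle HK // andbT mulf_neq0 //.
    by case: hsg => ->; rewrite ?oppr_eq0 oner_eq0.
  by apply: (generic_orient gP); rewrite /= !inE negb_or oz ![_ == i]eq_sym io iz.
split.
- apply: (main _ 1); [by left|by rewrite !inE orient_abb ltxx|].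
  by move=> i; rewrite !inE mul1r -leNgt.
- apply: (main _ (-1)); [by right|by rewrite !inE orient_aba ltxx|].
  by move=> i; rewrite left_rev mulN1r oppr_le0 -leNgt.
Qed.

(** The three triangles with apex [p] have positive areas that add up to that of [abc]. *)
Lemma in_hull_around a b c (p : R * R) : 0 < orient p (P a) (P b) ->
  0 < orient p (P b) (P c) -> 0 < orient p (P c) (P a) ->
  in_hull P [set a; b; c]%SET p.
Proof.
rewrite orient_cyc (orient_cyc p) (orient_cyc p (P c)) => hc ha hb.
have W0 : 0 < orient (P a) (P b) (P c).
  have -> : orient (P a) (P b) (P c) =
      orient (P a) (P b) p + orient (P b) (P c) p + orient (P c) (P a) p.
    by rewrite /orient /cross /=; ring.
  exact: addr_gt0 (addr_gt0 hc ha) hb.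
by apply: in_hull_triangle; rewrite ?gt_eqF ?mulr_ge0 // ltW.
Qed.

Section Others.
Variable o : I.
Hypothesis co : center P (P o).
Let ys := enum (~: [set o]%SET).
Let y (k : nat) : I := nth o ys k.
Let r (j k : nat) : bool := 0 < orient (P o) (P (y j)) (P (y k)).
Let l := [seq r p.1 p.2 | p <- pairs6].
Let s := beats (beats_table l).

Let size_ys : size ys = 6%N.
Proof.
by rewrite -cardE; apply/eqP; rewrite -(eqn_add2l #|[set o]%SET|) cardsC cI cards1.
Qed.

Let y_neq k : (k < 6)%N -> y k != o.
Proof.
move=> k6; have : y k \in ys by rewrite mem_nth // size_ys.
by rewrite mem_enum !inE.
Qed.

Let y_inj j k : (j < 6)%N -> (k < 6)%N -> (y j == y k) = (j == k).
Proof. by move=> j6 k6; rewrite nth_uniq ?size_ys // enum_uniq. Qed.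

Let y_surj i : i != o -> exists2 k, (k < 6)%N & i = y k.
Proof.
move=> io; have iy : i \in ys by rewrite mem_enum !inE.
by exists (index i ys); rewrite -?size_ys ?index_mem // /y nth_index.
Qed.

Let orient_neq0 j k : (j < 6)%N -> (k < 6)%N -> j != k ->
  orient (P o) (P (y j)) (P (y k)) != 0.
Proof.
move=> j6 k6 jk; apply: (generic_orient gP).
by rewrite /= !inE negb_or y_inj // jk !(eq_sym o) !y_neq.
Qed.

Let sE j k : (j < 6)%N -> (k < 6)%N -> s j k = r j k.
Proof.
apply: beatsE => {}j {}k j6 k6; rewrite /r.
have [<-|jk] /= := eqVneq j k; first by rewrite orient_abb ltxx.
by rewrite orient_swap oppr_gt0 -leNgt lt_neqAle orient_neq0.
Qed.

Let scoreE j : (j < 6)%N -> score s j = #|left P o (y j)|.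
Proof.
move=> j6; rewrite /score.
transitivity (count (fun i => i \in left P o (y j)) ys).
  have -> : ys = map y (iota 0 6) by rewrite -size_ys map_nth_iota0 // take_size.
  rewrite count_map; apply: eq_in_count => k; rewrite mem_iota => k6.
  by rewrite sE //= inE.
rewrite -size_filter cardE /ys /enum_mem -filter_predI; congr size.
apply: eq_filter => i; rewrite /= !inE; case: eqVneq => [->|]; rewrite ?andbT //.
by rewrite orient_aba ltxx.
Qed.

Let s_balanced : balanced s.
Proof.
apply/allP => j; rewrite mem_iota => j6; rewrite scoreE // !inE.
have yj := y_neq j6; rewrite eq_sym in yj.
have [h1 h2] := center_left_ge2 co yj; have := left_right cI gP yj.
case: #|left P o _| h1 => [|[|[|[|n]]]] // _.
by case: #|left P _ o| h2 => [|[|m]] // _; rewrite !addnS.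
Qed.

(** The three-term Grassmann-Plücker relation among four vectors would have only positive terms. *)
Let acyclic_out a b c d : (a < 6)%N -> (b < 6)%N -> (c < 6)%N -> (d < 6)%N ->
  s a b -> s a c -> s a d -> s b c -> s c d -> s d b -> False.
Proof.
move=> a6 b6 c6 d6; rewrite !sE // /r => ab ac ad bc cd db.
have := addr_gt0 (mulr_gt0 ab cd) (addr_gt0 (mulr_gt0 ad bc) (mulr_gt0 ac db)).
by rewrite (_ : _ + _ = 0) ?ltxx // /orient /cross; ring.
Qed.

Let s_locally_transitive : locally_transitive s.
Proof.
apply/allP => a; rewrite mem_iota => a6.
case E : [seq b <- iota 0 6 | s a b] => [|b [|c [|d [|? ?]]]] //.
have H x : x \in [:: b; c; d] -> (x < 6)%N /\ s a x.
  by rewrite -E mem_filter mem_iota => /andP[].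
have [|b6 ab] := H b; first by rewrite !inE eqxx.
have [|c6 ac] := H c; first by rewrite !inE eqxx orbT.
have [|d6 ad] := H d; first by rewrite !inE eqxx !orbT.
apply/negP => /orP[/andP[/andP[bc cd] db]|/andP[/andP[bd dc] cb]].
  exact: (acyclic_out a6 b6 c6 d6).
exact: (acyclic_out a6 b6 d6 c6).
Qed.

Let s_many_splits : many_splits s.
Proof. by apply: tournament_splits; rewrite // size_map. Qed.

Let cyclic3_hull a b c : (a < 6)%N -> (b < 6)%N -> (c < 6)%N ->
  cyclic3 s a b c -> in_hull P [set y a; y b; y c]%SET (P o).
Proof.
move=> a6 b6 c6 /orP[] /andP[/andP[]]; rewrite !sE // => h1 h2 h3.
  exact: in_hull_around.
apply: in_hullS (in_hull_around h1 h2 h3).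
by apply/fintype.subsetP => i; rewrite !inE -!orbA => /or3P[] ->; rewrite ?orbT.
Qed.

Let tri (p : nat * nat) : {set I} := [set y 0; y p.1; y p.2]%SET.
Let part p := parts3 [set o]%SET (tri p).

Let split_lt p : p \in splits -> [/\ (0 < p.1)%N, (p.1 < p.2)%N & (p.2 < 6)%N].
Proof.
have : all (fun p => [&& 0 < p.1, p.1 < p.2 & p.2 < 6])%N splits by [].
by move=> /allP H /H /and3P[].
Qed.

Let tri_mem p m : p \in splits -> (m < 6)%N ->
  (y m \in tri p) = (m \in [:: 0; p.1; p.2]%N).
Proof.
move=> /split_lt[p1 p12 p2] m6; have p16 := ltn_trans p12 p2.
by rewrite !inE !y_inj // orbA.
Qed.

(** The triangle is recognised in its partition as the part that contains [y 0]. *)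
Let part_inj : {in splits &, injective part}.
Proof.
move=> p q ps qs E; apply: splits_inj => // m; rewrite mem_iota => m6.
suff T : tri p = tri q by rewrite -!tri_mem // T.
have y0 t : y 0 \in tri t by rewrite !inE eqxx.
have : tri p \in part q by rewrite -E !inE eqxx orbT.
rewrite !inE -orbA => /or3P[/eqP h|/eqP //|/eqP h].
- by have := y0 p; rewrite h inE (negPf (y_neq _)).
- by have := y0 p; rewrite h !inE !eqxx orbT.
Qed.

Let part_tverberg p : p \in splits -> cyclic_split s p -> tverberg P (part p) (P o).
Proof.
move=> ps /andP[c1 c2]; have [p1 p12 p2] := split_lt ps.
have p16 := ltn_trans p12 p2.
have : all (fun p => let t := split_rest p in (size t == 3%N) &&
    all (fun m => (m < 6) && (m \notin [:: 0; p.1; p.2]))%N t) splits by [].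
move=> /allP/(_ p ps); case: split_rest c2 => [|m1 [|m2 [|m3 []]]] //= c2.
move=> /and4P[/andP[m16 n1] /andP[m26 n2] /andP[m36 n3] _].
have hr := cyclic3_hull m16 m26 m36 c2.
have o_tri : o \notin tri p by rewrite !inE !(eq_sym o) !negb_or !y_neq.
have sub : [set y m1; y m2; y m3]%SET \subset ~: ([set o] :|: tri p)%SET.
  apply/fintype.subsetP => i im.
  have {im} : [|| i == y m1, i == y m2 | i == y m3] by move: im; rewrite !inE -orbA.
  have M m : (m < 6)%N -> m \notin [:: 0; p.1; p.2]%N -> y m \in ~: ([set o] :|: tri p)%SET.
    by move=> m6; rewrite -tri_mem // finset.in_setC finset.in_setU finset.in_set1 negb_or y_neq.
  by case/or3P => /eqP->; apply: M.
apply: parts3P.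
- by apply/finset.set0Pn; exists o; rewrite inE.
- by apply/finset.set0Pn; exists (y 0); rewrite !inE eqxx.
- by apply/finset.set0Pn; exists (y m1); apply: (fintype.subsetP sub); rewrite !inE eqxx.
- by rewrite disjoints1.
- exact: in_hull_point.
- exact: cyclic3_hull.
- exact: in_hullS sub hr.
Qed.

(** A heavy line through [P o] has [o] as one of its two indices. With [o] first the other index has
    score 2, with [o] second it has score 3: the two cases of [wedge_dir]. *)
Let wedge m : (m < 6)%N -> wedge_dir s m -> forall a b, heavy P a b ->
  orient (P a) (P b) (P o) = 0 -> cross (P b - P a) (P (y m) - P o) <= 0.
Proof.
move=> m6 /allP wm a b ab abo; have /andP[nab l2] := ab.
have wz z : (z < 6)%N -> z != m -> if score s z == 3%N then r z m else ~~ r z m.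
  by move=> z6 zm; have := wm z; rewrite mem_iota (negPf zm) -!sE //; apply.
have [ao|ao] := eqVneq a o.
  rewrite ao in nab ab l2 *; rewrite eq_sym in nab.
  have [z z6 bz] := y_surj nab; rewrite bz in l2 *.
  have [->|zm] := eqVneq z m; first by rewrite -[cross _ _]/(orient _ _ _) orient_abb.
  have := wz z z6 zm; rewrite scoreE // ltn_eqF // => h.
  by rewrite leNgt.
have [bo|bo] := eqVneq b o; last first.
  have /(generic_orient gP)/eqP : uniq [:: a; b; o].
    by rewrite /= !inE negb_or nab ao bo.
  by [].
rewrite bo in ab nab l2 *; have [z z6 az] := y_surj ao; rewrite az in nab l2 *.
have E : cross (P o - P (y z)) (P (y m) - P o) = - orient (P o) (P (y z)) (P (y m)).
  by rewrite /orient /cross /=; ring.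
rewrite E oppr_le0; have [->|zm] := eqVneq z m; first by rewrite orient_abb.
have := wz z z6 zm; rewrite eq_sym in nab.
have [_ ge2] := center_left_ge2 co nab.
have := left_right cI gP nab.
have -> : #|left P (y z) o| = 2%N by apply/eqP; rewrite eqn_leq l2 ge2.
by rewrite scoreE // addn2 => -[->] /ltW.
Qed.

(* In the last alternative the centre region contains a segment from P o towards P i. *)
Lemma center_point_partitions : exists S : seq {set {set I}},
  [/\ uniq S, forall Q, Q \in S -> tverberg P Q (P o) /\ [set o]%SET \in Q,
      (2 <= size S)%N
    & (4 <= size S)%N \/ exists2 i, i != o & forall a b, heavy P a b ->
        orient (P a) (P b) (P o) = 0 -> cross (P b - P a) (P i - P o) <= 0].
Proof.
pose S := map part [seq t <- splits | cyclic_split s t].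
have sizeS : size S = count (cyclic_split s) splits by rewrite size_map size_filter.
have /andP[S2 S4] := s_many_splits.
exists S; rewrite sizeS; split => //.
- have inj : {in [seq t <- splits | cyclic_split s t] &, injective part}.
    by move=> p q; rewrite mem_filter => /andP[_ ps]; rewrite mem_filter => /andP[_ qs]; exact: part_inj.
  by rewrite (map_inj_in_uniq inj) filter_uniq.
- move=> Q /mapP[p]; rewrite mem_filter => /andP[cs ps] ->; split.
    exact: part_tverberg.
  by rewrite !inE eqxx.
- case/orP: S4 => [|/hasP[m]]; first by left.
  rewrite mem_iota => m6 wm; right; exists (y m); first exact: y_neq.
  exact: wedge.
Qed.

End Others.

End PointInCenter.

(** * Counting for points in general position *)

Section GenericPoints.
Variables (R : realType) (I : finType) (P : I -> R * R).
Hypotheses (cI : #|I| = 7%N) (gP : generic P).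
Implicit Types (a b c d e f g h i o : I) (p q u v : R * R) (Q : {set {set I}}).

Lemma crossing_seq (s : seq (R * R)) : uniq s ->
  (forall p, p \in s -> exists Q, crossing P Q p) ->
  exists S : seq {set {set I}}, [/\ uniq S, size S = size s &
    forall Q, Q \in S -> exists2 p, p \in s & crossing P Q p].
Proof.
elim: s => [|p s IH] /=; first by exists [::].
move=> /andP[ps us] H; have [|S [uS sS HS]] := IH us.
  by move=> q qs; apply: H; rewrite inE qs orbT.
have [|Q QP] := H p; first by rewrite inE eqxx.
exists (Q :: S); split => /=; last 2 [by rewrite sS].
- rewrite uS andbT; apply/negP => /HS[q qs Qq].
  by move: ps; rewrite (crossing_point gP QP (proj1 Qq)) qs.
- move=> Q'; rewrite inE => /predU1P[->|/HS[q qs Qq]].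
    by exists p => //; rewrite inE eqxx.
  by exists q => //; rewrite inE qs orbT.
Qed.

(** Walks along the two edges at a vertex [p1] give [p2] and [p3]. If the second lines of these
    agree, [triangle_center] finds a central point; otherwise the second edge at [p2] leads to a
    fourth vertex. *)
Lemma no_center_point_four : (forall i, ~ center P (P i)) ->
  exists S : seq {set {set I}}, [/\ uniq S, (4 <= size S)%N &
    forall Q, Q \in S -> exists p, tverberg P Q p].
Proof.
move=> none.
have off a b c d p : vertex P a b c d p -> forall i, p != P i.
  by move=> [cp _ _ _ _] i; apply: contra_notN (none i) => /eqP <-.
have [|p1 [[a [b [c [d V1]]]] _ _]] := @lexmax_vertex _ _ _ cI gP (1, 0) (0, 1).
  by rewrite /cross /= mulr0 subr0 mulr1 oner_eq0.
have [p2 [e [f [V2 n21]]]] := walk cI gP V1 (off _ _ _ _ _ V1).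
have [p3 [g [h [V3 n31]]]] := walk cI gP (vertexC V1) (off _ _ _ _ _ V1).
have [_ [hab hcd] ab1 cd1 nz1] := V1; have [_ [_ hef] ab2 ef2 nz2] := V2.
have [_ [_ hgh] cd3 gh3 nz3] := V3.
have on12 q : orient (P a) (P b) q = 0 -> orient (P c) (P d) q = 0 -> q = p1.
  by move=> abq cdq; apply: lines_meet_once nz1 abq cdq ab1 cd1.
have n23 : p2 != p3.
  by apply: contraNneq n21 => E; apply/eqP/on12; rewrite // E.
have [E|nefgh] := eqVneq (e, f) (g, h).
  move: V3; case: E => <- <- V3.
  have [i ci] := triangle_center cI gP V1 V2 V3 (off _ _ _ _ _ V1) (off _ _ _ _ _ V2)
    (off _ _ _ _ _ V3).
  by case: (none i).
have nefcd : (e, f) <> (c, d).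
  by move=> [E1 E2]; move/eqP: n21; apply; apply: on12; rewrite // -E1 -E2.
have nefab : (e, f) <> (a, b).
  move=> [E1 E2]; move: nz2; rewrite E1 E2 /cross.
  by rewrite [X in _ - X]mulrC subrr eqxx.
have [p4 [i [j [V4 n42]]]] := walk cI gP (vertexC V2) (off _ _ _ _ _ V2).
have [_ [_ _] ef4 _ _] := V4.
(* The line [ef] contains [p4] but, by [third_line], neither [p1] nor [p3]. *)
have n41 : p4 != p1.
  apply/eqP => E; rewrite E in ef4.
  by have [] := third_line cI gP V1 (off _ _ _ _ _ V1) hef ef4.
have n43 : p4 != p3.
  apply/eqP => E; rewrite E in ef4.
  have [//|Eg] := third_line cI gP V3 (off _ _ _ _ _ V3) hef ef4.
  by move: nefgh; rewrite Eg eqxx.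
have [||S [uS sS HS]] := @crossing_seq [:: p1; p2; p3; p4].
- rewrite /= !inE !negb_or (eq_sym p1) n21 (eq_sym p1) n31 (eq_sym p1) n41.
  by rewrite n23 (eq_sym p2) n42 (eq_sym p3) n43.
- move=> p; rewrite !inE => /or4P[] /eqP->; apply: vertex_crossing => //.
  + exact: V1. + exact: off V1. + exact: V2. + exact: off V2.
  + exact: V3. + exact: off V3. + exact: V4. + exact: off V4.
- exists S; split; rewrite ?sS // => Q /HS[p _ [t _]]; by exists p.
Qed.

Lemma center_point_four o : center P (P o) ->
  exists S : seq {set {set I}}, [/\ uniq S, (4 <= size S)%N &
    forall Q, Q \in S -> exists p, tverberg P Q p].
Proof.
move=> co; have [S [uS HS S2 S4]] := center_point_partitions cI gP co.
have tvS Q : Q \in S -> exists p, tverberg P Q p.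
  by move=> /HS[tQ _]; exists (P o).
case: S4 => [S4|[y yo Hy]]; first by exists S.
(* A partition with [o] alone in a part can meet only at [P o], so those meeting elsewhere are
   new. *)
have at_o Q p : Q \in S -> tverberg P Q p -> p = P o.
  by move=> /HS[_ oQ] [_ _ hp]; apply: in_hull1P; exact: hp.
have combine S' : uniq S' -> (2 <= size S')%N ->
    (forall Q, Q \in S' -> exists2 p, p != P o & tverberg P Q p) ->
    exists S : seq {set {set I}}, [/\ uniq S, (4 <= size S)%N &
      forall Q, Q \in S -> exists p, tverberg P Q p].
  move=> uS' S'2 HS'; exists (S ++ S'); split.
  - rewrite cat_uniq uS uS' andbT; apply/hasPn => Q /HS'[p po tQ].
    by apply: contra po => QS; apply/eqP; exact: at_o tQ.
  - by rewrite size_cat (leq_add S2 S'2).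
  - by move=> Q; rewrite mem_cat => /orP[/tvS //|/HS'[p _ tQ]]; exists p.
have [[o' [co' oo']]|uo] := pselect (exists o', center P (P o') /\ o' != o).
  have [S' [uS' HS' S'2 _]] := center_point_partitions cI gP co'.
  apply: (combine S') => // Q /HS'[tQ _]; exists (P o') => //.
  by apply: contra oo' => /eqP/(P_inj cI gP)->.
have off a b c d p : vertex P a b c d p -> p != P o -> forall i, p != P i.
  move=> [cp _ _ _ _] po i; apply/eqP => E; case: uo; exists i; split; first by rewrite -E.
  by apply: contra po => /eqP <-; rewrite E.
(* The centre region contains a point in direction [u] from [P o], so a vertex maximising [u] is not
   [P o]. *)
pose u := P y - P o; pose n := (- u.2, u.1).
have [e e0 ce] := center_move co Hy.
have u0 : 0 < dot u u.
  by rewrite dot_gt0 // subr_eq0; apply: contraNneq yo => /(P_inj cI gP)->.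
have un : cross u n != 0.
  have -> : cross u n = dot u u by rewrite /n /cross /dot /=; ring.
  by rewrite gt_eqF.
have [p1 [[a [b [c [d V1]]]] max1 _]] := lexmax_vertex cI gP un.
have n1o : p1 != P o.
  apply/eqP => E; have := max1 _ ce; rewrite leNgt => /negP; apply; rewrite E.
  have -> : dot u ((P o).1 + e * (P y - P o).1, (P o).2 + e * (P y - P o).2) =
    dot u (P o) + e * dot u u by rewrite /dot /u /=; ring.
  by rewrite ltrDl pmulr_rgt0.
have off1 := off _ _ _ _ _ V1 n1o.
have [p2 [i [j [V2 n21]]]] := walk cI gP V1 off1.
have [p3 [g [h [V3 n31]]]] := walk cI gP (vertexC V1) off1.
(* If [p2] and [p3] were both [P o], the two lines at [p1] would meet there, and [p1] would be
   [P o]. *)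
have [p [a' [b' [c' [d' [V po p1p]]]]]] : exists p a' b' c' d',
    [/\ vertex P a' b' c' d' p, p != P o & p1 != p].
  have [E2|] := eqVneq p2 (P o); last by move=> ?; exists p2, a, b, i, j; split; rewrite // eq_sym.
  have [E3|] := eqVneq p3 (P o); last by move=> ?; exists p3, c, d, g, h; split; rewrite // eq_sym.
  have [_ _ ab1 cd1 nz] := V1; have [_ _ ab2 _ _] := V2; have [_ _ cd3 _ _] := V3.
  rewrite E2 in ab2; rewrite E3 in cd3.
  by move: n21; rewrite E2 (lines_meet_once nz ab2 cd3 ab1 cd1) eqxx.
have [||S' [uS' sS' HS']] := @crossing_seq [:: p1; p].
- by rewrite /= inE p1p.
- move=> q; rewrite !inE => /orP[] /eqP->.
    exact: (vertex_crossing cI gP V1 off1).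
  exact: (vertex_crossing cI gP V (off _ _ _ _ _ V po)).
- apply: (combine S'); rewrite ?sS' // => Q /HS'[q qs [tQ _]]; exists q => //.
  by move: qs; rewrite !inE => /orP[]/eqP->.
Qed.

Lemma generic_four : exists S : seq {set {set I}}, [/\ uniq S, (4 <= size S)%N &
  forall Q, Q \in S -> exists p, tverberg P Q p].
Proof.
have [[o co]|none] := pselect (exists o, center P (P o)).
  exact: center_point_four co.
by apply: no_center_point_four => i ci; apply: none; exists i.
Qed.

End GenericPoints.

(** * Perturbation *)

Section ExplicitGeneric.

(* Found by random search. *)
Definition seven_points : seq (BinNums.Z * BinNums.Z) :=
  [:: (8, 7); (9, 0); (4, 7); (2, 6); (1, 1); (6, 9); (3, 4)].

Let pt (i : nat) : BinNums.Z * BinNums.Z := nth (0, 0) seven_points i.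

(** Repetitions are cut off as soon as they occur. Choices are accumulated at the head, so [p] sees
    them in reverse order. *)
Fixpoint forall_uniq n (acc : seq nat) (p : pred (seq nat)) : bool :=
  if n is m.+1 then
    all (fun i => if i \in acc then true else forall_uniq m (i :: acc) p) (iota 0 7)
  else p acc.

Lemma forall_uniqP n acc p l : forall_uniq n acc p -> size l = n ->
  uniq (catrev l acc) -> all (fun i => i < 7)%N l -> p (catrev l acc).
Proof.
elim: n acc l => [|n IH] acc; first by case.
case=> [|i l] // /allP H /= [sl] un /andP[i7 l7].
have := H i; rewrite mem_iota i7 => /(_ isT); case: ifP => [iacc|_ h]; last exact: IH.
by move: un; rewrite catrevE cat_uniq /= iacc !andbF.
Qed.

Lemma seven_points_orient : forall_uniq 3 [::] (fun l =>
  if l is [:: a; b; c] then orient (pt a) (pt b) (pt c) != 0 else false).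
Proof. by vm_compute. Qed.

Lemma seven_points_cross : forall_uniq 4 [::] (fun l =>
  if l is [:: a; b; c; d] then cross (pt b - pt a) (pt d - pt c) != 0 else false).
Proof. by vm_compute. Qed.

Lemma seven_points_concur : forall_uniq 6 [::] (fun l =>
  if l is [:: a; b; c; d; e; f] then
    concur (pt a) (pt b) (pt c) (pt d) (pt e) (pt f) != 0 else false).
Proof. vm_cast_no_check (erefl true). Qed.

End ExplicitGeneric.

Section GenericExists.
Variables (R : realType) (I : finType).
Hypothesis cI : #|I| = 7%N.

Let lab (i : I) : nat := enum_rank i.
Let phi (z : BinNums.Z) : R := (int_of_Z z)%:~R.
Let V (i : I) : R * R := let z := nth (0, 0) seven_points (lab i) in (phi z.1, phi z.2).

Let phi_neq0 z : z != 0 -> phi z != 0.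
Proof. by rewrite /phi intr_eq0; apply: contraNneq => z0; rewrite -(int_of_ZK z) z0. Qed.

(** The genericity conditions are polynomials with integer coefficients, so their non-zero values at
    [seven_points], computed in [BinNums.Z], are carried to [R] by the ring morphism [phi]. *)
Lemma generic_exists : exists W : I -> R * R, generic W.
Proof.
have phiD x y : phi (x + y) = phi x + phi y by rewrite /phi !rmorphD.
have phiN x : phi (- x) = - phi x by rewrite /phi !rmorphN.
have phiM x y : phi (x * y) = phi x * phi y by rewrite /phi !rmorphM.
have test n (p : pred (seq nat)) (l : seq I) : forall_uniq n [::] p -> size l = n ->
    uniq l -> p (map lab l).
  move=> fp sl ul.
  have := @forall_uniqP n [::] p (rev (map lab l)) fp.
  rewrite catrevE revK cats0 size_rev size_map map_inj_uniq; last first.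
    by move=> i j /val_inj/enum_rank_inj.
  by apply => //; rewrite all_rev all_map; apply/allP => i _ /=; rewrite -cI ltn_ord.
exists V; split.
- move=> a b c /(test _ _ [:: a; b; c] seven_points_orient erefl)/phi_neq0.
  by rewrite /orient /cross /= !(phiD, phiN, phiM).
- move=> a b c d /(test _ _ [:: a; b; c; d] seven_points_cross erefl)/phi_neq0.
  by rewrite /cross /= !(phiD, phiN, phiM).
- move=> a b c d e f /(test _ _ [:: a; b; c; d; e; f] seven_points_concur erefl)/phi_neq0.
  by rewrite /concur /orient /cross /= !(phiD, phiN, phiM).
Qed.

End GenericExists.

(** * Moving to general position along segments *)

Section Perturbation.
Variables (R : realType) (I : finType) (P V : I -> R * R).

Definition path_pt (t : R) (i : I) : R * R :=
  ((P i).1 + t * ((V i).1 - (P i).1), (P i).2 + t * ((V i).2 - (P i).2)).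

(** There are more candidates [d / (n + 2)] than roots; the 2 keeps them below [d]. *)
Lemma nonroot_small (p : {poly R}) (d : R) : p != 0 -> 0 < d ->
  exists2 t, 0 < t < d & p.[t] != 0.
Proof.
move=> p0 d0; pose rs := [seq d / n.+2%:R | n <- iota 0 (size p)].
have : ~~ all (root p) rs.
  apply/negP => /(max_poly_roots p0); rewrite size_map size_iota ltnn.
  suff -> : uniq rs by move=> /(_ isT).
  rewrite map_inj_uniq ?iota_uniq // => m n /(mulfI (lt0r_neq0 d0))/invr_inj/eqP.
  by rewrite eqr_nat => /eqP[].
move=> /allPn[t /mapP[n _ ->] nr]; exists (d / n.+2%:R) => //.
by rewrite divr_gt0 //= ltr_pdivrMr // ltr_pMr // ltr1n.
Qed.

(** Each condition is a polynomial in [t] that does not vanish at [t = 1], where the path reaches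
    [V]; their product is a non-zero polynomial. *)
Lemma generic_path (d : R) : generic V -> 0 < d ->
  exists2 t, 0 < t < d & generic (path_pt t).
Proof.
move=> gV d0.
pose pp i : {poly R} * {poly R} := ((P i).1%:P + 'X * ((V i).1 - (P i).1)%:P,
  (P i).2%:P + 'X * ((V i).2 - (P i).2)%:P).
have ppE t : [/\ forall a b c, (orient (pp a) (pp b) (pp c)).[t] =
      orient (path_pt t a) (path_pt t b) (path_pt t c),
    forall a b c e, (cross (pp b - pp a) (pp e - pp c)).[t] =
      cross (path_pt t b - path_pt t a) (path_pt t e - path_pt t c) &
    forall a b c e f g, (concur (pp a) (pp b) (pp c) (pp e) (pp f) (pp g)).[t] =
      concur (path_pt t a) (path_pt t b) (path_pt t c) (path_pt t e) (path_pt t f)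
        (path_pt t g)].
  have EO a b c : (orient (pp a) (pp b) (pp c)).[t] =
      orient (path_pt t a) (path_pt t b) (path_pt t c).
    by rewrite /orient /cross /= !hornerE.
  split=> // *.
    by rewrite /cross /= !hornerE.
  by rewrite /concur [LHS]hornerD hornerN !hornerM !EO.
have path1 i : path_pt 1 i = V i by apply: plane_eq; rewrite /= mul1r addrC subrK.
have nz (p : {poly R}) : p.[1] != 0 -> p != 0.
  by apply: contraNneq => ->; rewrite horner0.
have [E1 E2 E3] := ppE 1; have [G1 G2 G3] := gV.
pose p1 := \prod_(x : I * I * I | uniq [:: x.1.1; x.1.2; x.2])
  orient (pp x.1.1) (pp x.1.2) (pp x.2).
pose p2 := \prod_(x : I * I * (I * I) | uniq [:: x.1.1; x.1.2; x.2.1; x.2.2])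
  cross (pp x.1.2 - pp x.1.1) (pp x.2.2 - pp x.2.1).
pose p3 := \prod_(x : I * I * (I * I) * (I * I) |
    uniq [:: x.1.1.1; x.1.1.2; x.1.2.1; x.1.2.2; x.2.1; x.2.2])
  concur (pp x.1.1.1) (pp x.1.1.2) (pp x.1.2.1) (pp x.1.2.2) (pp x.2.1) (pp x.2.2).
have p1n : p1 != 0.
  by apply/prodf_neq0 => x ux; apply: nz; rewrite E1 !path1; apply: G1.
have p2n : p2 != 0.
  by apply/prodf_neq0 => x ux; apply: nz; rewrite E2 !path1; apply: G2.
have p3n : p3 != 0.
  by apply/prodf_neq0 => x ux; apply: nz; rewrite E3 !path1; apply: G3.
have [|t td] := @nonroot_small (p1 * p2 * p3) d _ d0; first by rewrite !mulf_neq0.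
rewrite !hornerM !mulf_eq0 !negb_or => /andP[/andP[n1 n2] n3].
exists t => //; have [F1 F2 F3] := ppE t; split.
- move=> a b c un; move: n1; rewrite horner_prod => /prodf_neq0/(_ (a, b, c) un).
  by rewrite /= F1.
- move=> a b c e un; move: n2; rewrite horner_prod => /prodf_neq0/(_ (a, b, (c, e)) un).
  by rewrite /= F2.
- move=> a b c e f g un; move: n3.
  rewrite horner_prod => /prodf_neq0/(_ (a, b, (c, e), (f, g)) un).
  by rewrite /= F3.
Qed.

Definition hulls_meet (W : I -> R * R) (Q : {set {set I}}) : Prop :=
  exists p, forall A, A \in Q -> in_hull W A p.

Lemma continuous_sum (T : topologicalType) (J : finType) (g : J -> T -> R) :
  (forall k, continuous (g k)) -> continuous (fun x => \sum_k g k x).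
Proof.
move=> cg; elim: (index_enum J) => [|k s IH].
  by under eq_fun do rewrite big_nil; move=> x; exact: cvg_cst.
by under eq_fun do rewrite big_cons; move=> x; apply: cvgD; [exact: cg|exact: IH].
Qed.

(* The parameters t are the projection of a compact set of pairs (weights, t). *)
Lemma closed_hulls_meet (Q : {set {set I}}) :
  closed [set t : R | 0 <= t <= 1 /\ hulls_meet (path_pt t) Q]%classic.
Proof.
pose T := ({set I} * I)%type.
pose w (A : {set I}) (i : I) (x : 'rV[R]_#|{: T}| * R) : R := x.1 0 (enum_rank (A, i)).
have cw A i : continuous (w A i).
  by move=> x; apply: (@continuous_comp _ _ _ fst (fun v : 'rV[R]__ => v 0 _));
    [exact: cvg_fst|exact: coord_continuous].
pose mom (k : bool) (A : {set I}) (x : 'rV[R]_#|{: T}| * R) : R :=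
  \sum_i w A i x * (if k then (path_pt x.2 i).1 else (path_pt x.2 i).2).
have ca (a c : R) : continuous (fun x : 'rV[R]_#|{: T}| * R => a + x.2 * c).
  move=> x; apply: cvgD; first exact: cvg_cst.
  by apply: cvgM; [exact: cvg_snd|exact: cvg_cst].
have cm k A : continuous (mom k A).
  apply: continuous_sum => i x; apply: cvgM; first exact: cw.
  by case: k; exact: ca.
have cs A : continuous (fun x => \sum_i w A i x) by apply: continuous_sum.
pose box := ([set v : 'rV[R]_#|{: T}| | forall k, `[0, 1]%classic (v ord0 k)] `*`
  `[0 : R, 1])%classic.
have cbox : compact box.
  apply: compact_setX; last exact: segment_compact.
  apply: (@rV_compact _ _ (fun=> `[0 : R, 1]%classic)) => k; exact: segment_compact.
(* With the box, [C1] makes weights vanish off their part. Equalities are split into inequalities to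
   fit [closed_forall_le]: [C2] and [C3] for the sums, [C4] in both orders for the coordinates of
   the common point. *)
pose C1 := [set x | forall t : T, t.1 \in Q /\ t.2 \notin t.1 -> w t.1 t.2 x <= 0]%classic.
pose C2 := [set x | forall A, A \in Q -> \sum_i w A i x - 1 <= 0]%classic.
pose C3 := [set x | forall A, A \in Q -> 1 - \sum_i w A i x <= 0]%classic.
pose C4 := [set x | forall t : bool * ({set I} * {set I}), t.2.1 \in Q /\ t.2.2 \in Q ->
  mom t.1 t.2.1 x - mom t.1 t.2.2 x <= 0]%classic.
pose C := (box `&` (C1 `&` (C2 `&` (C3 `&` C4))))%classic.
have cC : compact C.
  apply: compact_closedI => //; do !apply: closedI; apply: closed_forall_le.
  - by move=> t; exact: cw.
  - by move=> A x; apply: cvgB; [exact: cs|exact: cvg_cst].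
  - by move=> A x; apply: cvgB; [exact: cvg_cst|exact: cs].
  - by move=> t x; apply: cvgB; exact: cm.
have -> : [set t : R | 0 <= t <= 1 /\ hulls_meet (path_pt t) Q]%classic =
    (snd @` C)%classic.
  apply/seteqP; split => [t [t01 [p hp]]|t [[v t'] [[/= v01 t01] [h1 [h2 [h3 h4]]]] /= <-]].
    have /choice[W HW] : forall A, exists W : I -> R, A \in Q ->
        [/\ forall i, 0 <= W i, forall i, i \notin A -> W i = 0, \sum_i W i = 1
          & p = (\sum_i W i * (path_pt t i).1, \sum_i W i * (path_pt t i).2)].
      by move=> A; case: (boolP (A \in Q)) => [/hp[W HW]|_]; [exists W|exists (fun=> 0)].
    (* Sets outside [Q] receive zero weights, which stay in the box. *)
    pose v : 'rV[R]_#|{: T}| := \row_k (let: (A, i) := enum_val k in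
      if A \in Q then W A i else 0).
    have wE A i : A \in Q -> w A i (v, t) = W A i.
      by move=> AQ; rewrite /w /= mxE enum_rankK AQ.
    exists (v, t) => //; split; first split => /=.
    - move=> k; rewrite mxE; case: (enum_val k) => A i /=; case: ifP => AQ; last first.
        by rewrite in_itv /= lexx ler01.
      have [W0 _ W1 _] := HW A AQ; rewrite in_itv /= W0 -W1 (bigD1 i) //= lerDl.
      by apply: sumr_ge0.
    - by rewrite in_itv.
    - split=> [[A i] [/= AQ iA]|]; first by have [_ W0 _ _] := HW A AQ; rewrite /= wE // W0.
      have sE A : A \in Q -> \sum_i w A i (v, t) = 1.
        by move=> AQ; have [_ _ <- _] := HW A AQ; apply: eq_bigr => i _; rewrite wE.
      split=> [A AQ|]; first by rewrite sE // subrr.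
      split=> [A AQ|]; first by rewrite sE // subrr.
      move=> [k [A B]] [/= AQ BQ].
      have mE D : D \in Q -> mom k D (v, t) = if k then p.1 else p.2.
        move=> DQ; have [_ _ _ ->] := HW D DQ; rewrite /mom; case: k => /=;
        by apply: eq_bigr => i _; rewrite wE.
      by rewrite !mE // subrr.
  split; first by move: t01; rewrite /= in_itv.
  have w0 A i : 0 <= w A i (v, t').
    by have := v01 (enum_rank (A, i)); rewrite /= in_itv /= => /andP[].
  have HE A : A \in Q -> in_hull (path_pt t') A (mom true A (v, t'), mom false A (v, t')).
    move=> AQ; exists (fun i => w A i (v, t')); split => //.
      by move=> i iA; apply/eqP; rewrite eq_le w0 andbT; apply: (h1 (A, i)).
    apply/eqP; rewrite -subr_eq0 eq_le (h2 A AQ) -oppr_le0 opprB; exact: h3.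
  have [->|/finset.set0Pn[A AQ]] := eqVneq Q finset.set0.
    by exists 0 => A; rewrite inE.
  exists (mom true A (v, t'), mom false A (v, t')) => B BQ.
  have mE k : mom k A (v, t') = mom k B (v, t').
    apply/eqP; rewrite -subr_eq0 eq_le (h4 (k, (A, B))) //= -oppr_le0 opprB.
    exact: (h4 (k, (B, A))).
  by rewrite !mE; exact: HE.
apply: compact_closed; first exact: norm_hausdorff.
apply: continuous_compact => //; apply: continuous_subspaceT => x; exact: cvg_snd.
Qed.

End Perturbation.

(** * Finite convex combinations in convex sets *)

Section ConvexHull.
Local Open Scope convex_scope.

(** [convex_set] speaks of two points only. Induction on the number of non-zero weights: one point
    is split off and the other weights are divided by [1 - w i]. *)
Lemma convex_set_sum (R : realType) (M : lmodType R) (C : set (convex_lmodType M))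
    (J : finType) (w : J -> R) (x : J -> M) :
  convex_set C -> (forall i, 0 <= w i) -> \sum_i w i = 1 ->
  (forall i, w i != 0 -> C (x i)) -> C (\sum_i w i *: x i).
Proof.
move=> cC; have [n] := ubnP #|[pred i | w i != 0]|.
elim: n w => // n IH w wn w0 w1 wC.
have [i wi] : exists i, w i != 0.
  apply/existsP; apply: contraT => /existsPn none.
  move: w1; rewrite big1 => [/eqP|i _]; first by rewrite eq_sym oner_eq0.
  by have := none i; rewrite negbK => /eqP.
have D (h : J -> M) : \sum_j w j *: h j = w i *: h i + \sum_(j | j != i) w j *: h j.
  by rewrite (bigD1 i).
have w1' : \sum_(j | j != i) w j = 1 - w i
  by apply: (canRL (addrK _)); rewrite -w1 [RHS](bigD1 i) //= addrC.
have [wi1|wi1] := eqVneq (w i) 1.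
  rewrite D big1 ?addr0 ?wi1 ?scale1r; first exact: wC.
  move=> j ji; move/eqP: w1'; rewrite wi1 subrr psumr_eq0 // => /allP/(_ j).
  by rewrite mem_index_enum ji => /(_ isT)/eqP->; rewrite scale0r.
have lt1 : 0 < 1 - w i.
  by rewrite -w1' lt_neqAle sumr_ge0 // andbT eq_sym w1' subr_eq0 eq_sym.
pose w' j := if j == i then 0 else w j / (1 - w i).
have w'E j : j != i -> w' j = w j / (1 - w i) by rewrite /w' => /negPf->.
have w'i : w' i = 0 by rewrite /w' eqxx.
have C' : C (\sum_j w' j *: x j).
  apply: IH => [|j||j].
  - rewrite ltnS in wn; apply: leq_trans wn; apply: proper_card.
    apply/properP; split; last by exists i; rewrite !inE ?w'i ?eqxx.
    apply/fintype.subsetP => j; rewrite !inE.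
    have [->|ji] := eqVneq j i; first by rewrite w'i eqxx.
    by rewrite w'E // mulf_eq0 negb_or => /andP[].
  - have [->|ji] := eqVneq j i; first by rewrite w'i.
    by rewrite w'E // divr_ge0 // ltW.
  - rewrite (bigD1 i) //= w'i add0r (eq_bigr (fun j => w j / (1 - w i))) //.
    by rewrite -mulr_suml w1' divff // gt_eqF.
  - have [->|ji] := eqVneq j i; first by rewrite w'i eqxx.
    by rewrite w'E // mulf_eq0 negb_or => /andP[/wC].
have le1 : w i <= 1 by rewrite -subr_ge0 ltW.
have := cC (x i) (\sum_j w' j *: x j) (Itv01 (w0 i) le1).
rewrite !inE => /(_ (wC i wi) C').
congr C; rewrite D; congr (_ + _); rewrite /= scaler_sumr (bigD1 i) //= w'i scale0r scaler0 add0r.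
apply: eq_bigr => j ji; rewrite w'E // scalerA; congr (_ *: _).
by rewrite -[LHS]/((1 - w i) * (w j / (1 - w i))) mulrC divfK // gt_eqF.
Qed.

End ConvexHull.

(** * Passage to the limit *)

Section MainTheorem.
Variables (R : realType) (X : {fset 'rV[R]_2}).

Let coords (i : X) : R * R := (val i 0 0, val i 0 1).

Lemma tverberg_partitions_intro (Q : {set {set X}}) :
  finset.partition Q [set: X]%SET -> #|Q| = 3%N -> hulls_meet coords Q ->
  Q \in tverberg_partitions X 3.
Proof.
move=> partQ cQ [p hp]; rewrite inE partQ cQ eqxx /=; apply/asboolP.
exists (\row_k (if k == 0 then p.1 else p.2)) => A /= AQ C [cC AC].
have [w [w0 wA w1 pw]] := hp A AQ.
have -> : \row_k (if k == 0 then p.1 else p.2) = \sum_i w i *: val i.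
  apply/rowP => k; rewrite mxE summxE.
  under eq_bigr do rewrite mxE.
  case: (unliftP 0 k) => [k' ->|->] /=; last by rewrite pw.
  by rewrite (ord1 k') pw; apply: eq_bigr => i _; congr (_ * val i _ _); apply: val_inj.
apply: convex_set_sum => // i wi; apply: AC; exists i => //=.
by apply: contraNT wi => /wA ->.
Qed.

(** A partition whose hulls do not meet for [X] still fails for small [t], by [closed_hulls_meet].
    As there are finitely many partitions, those found at a small generic [t] are all Tverberg
    partitions of [X]. *)
Lemma four_tverberg_partitions : #|` X| = 7%N -> (4 <= #|tverberg_partitions X 3|)%N.
Proof.
rewrite cardfE => cX; have [V gV] := @generic_exists R X cX.
pose F (Q : {set {set X}}) := [set t : R | 0 <= t <= 1 /\
  hulls_meet (path_pt coords V t) Q]%classic.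
have P0 : path_pt coords V 0 = coords.
  by apply/funext => i; apply: plane_eq; rewrite /= mul0r addr0.
have near0 : \forall t \near (0 : R), forall Q, ~ hulls_meet coords Q -> ~ F Q t.
  apply: (@filter_forall _ ({set {set X}} : finType) (fun Q t => ~ hulls_meet coords Q -> ~ F Q t)
    (nbhs (0 : R)) (nbhs_filter _)) => Q; have [hQ|nQ] := pselect (hulls_meet coords Q).
    by apply: nearW => t /(_ hQ).
  have /closed_openC oF := @closed_hulls_meet _ _ coords V Q.
  have : nbhs (0 : R) (~` F Q)%classic.
    by apply: open_nbhs_nbhs; split => //= -[_]; rewrite P0.
  by apply: filterS => t Ft _.
have /nbhs_ballP[d /= d0 Hd] := near0.
(* The bound 1 is there because [F] only contains parameters between 0 and 1. *)
have [t /andP[t0 td] gt] : exists2 t, 0 < t < Num.min d 1 & generic (path_pt coords V t).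
  by apply: generic_path => //; rewrite lt_min d0 ltr01.
move: td; rewrite lt_min => /andP[td t1].
have [S [uS S4 HS]] := generic_four cX gt.
rewrite (leq_trans S4) // -(card_uniqP uS); apply/subset_leq_card/fintype.subsetP => Q QS.
have [p [partQ cQ hp]] := HS Q QS.
apply: tverberg_partitions_intro => //; apply: contrapT => nQ.
apply: (Hd t _ Q nQ); first by rewrite /ball /= sub0r normrN gtr0_norm.
by split; [rewrite !ltW|exists p].
Unshelve. all: by end_near.
Qed.

End MainTheorem.

End SevenPoints.

Theorem theorem1p3 (R : realType) (X : {fset 'rV[R]_2}) (hX : #|` X| = 7) :
  4 <= #|tverberg_partitions X 3|.
Proof. exact: SevenPoints.four_tverberg_partitions hX. Qed.
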